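(* Consider a linear optimization problem in standard form with integer data $(A,b,c)$, $A\in\mathbb R^{m\times n}$ of full row rank, and the iterative refinement method described in the context. The total time complexity of finding an exact optimal solution with the iterative refinement method using IF-QIPM as limited-precision solver (IR-IF-QIPM) is $$\tilde O_{n,\kappa_Q,\omega,\mu^0,L}\!\left(n^{2.5}\,L\,\kappa_Q^2\,\|Q\|\,\omega^5\right).$$ Furthermore, the total number of arithmetic operations of the iterative refinement method using IF-IPM with the conjugate gradient method as limited-precision solver (IR-IF-IPM) is at most $$\tilde O_{\mu^0,L}\!\left(n^{2.5}\,L\,\kappa_Q\,\omega^2\right).$$
   Context: Notation. $\tilde O_{p_1,p_2,\dots}$ is big-O with factors polylogarithmic in the listed quantities suppressed. $\|\cdot\|$ is the spectral (2-) norm, $\|\cdot\|_F$ the Frobenius norm, $\kappa$ the condition number. LO pair: $\min c^Tx$ s.t. $Ax=b$, $x\ge0$; $\max b^Ty$ s.t. $A^Ty+s=c$, $s\ge0$. $L=mn+m+n+\sum_{i,j}\lceil\log(|a_{ij}|+1)\rceil+\sum_i\lceil\log(|c_i|+1)\rceil+\sum_j\lceil\log(|b_j|+1)\rceil$ is the binary input length; an exact optimal solution is obtained by the standard rounding procedure from a feasible solution with $x^Ts/n\le 2^{-O(L)}$. $X=\mathrm{diag}(x)$, $S=\mathrm{diag}(s)$, $\mu=x^Ts/n$, $e$ all-ones, $\mathcal N(\theta)=\{(x,y,s)\text{ feasible},\ x,s>0,\ \|XSe-\mu e\|_2\le\theta\mu\}$. An initial $(x^0,y^0,s^0)\in\mathcal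 N(\theta)$ is given, with $\mu^0=(x^0)^Ts^0/n$. With $A=[A_B\ A_N]$, $A_B$ nonsingular, $V=\begin{bmatrix}A_B^{-1}A_N\\-I\end{bmatrix}$, and $Q=\begin{bmatrix}A&0\\0&V^T\end{bmatrix}$, $\kappa_Q=\kappa(Q)$. The cost of computing $V$ is neglected. $\omega$ is an upper bound on $\|x\|$ and $\|s\|$ over all iterates occurring. Limited-precision solvers. Both IF-IPM and IF-QIPM, for target precision $\hat\zeta$, use $\eta=0.1$, $\beta=1-0.11/\sqrt n$, and $\theta=0.2$ (IF-IPM) or $\theta=0.3$ (IF-QIPM). At iteration $k$ they solve the orthogonal subspaces system $M^kz=\sigma^k$, $M^k=[-X^kA^T\ \ S^kV]$, $z=(\Delta y,\lambda)$, $\sigma^k=\beta\mu^ke-X^ks^k$, with residual of norm at most $\eta\mu^k$, set $\Delta x=V\lambda$, $\Delta s=-A^T\Delta y$, take a full step, and stop when the required precision is reached. - In IF-IPM with CGM the system is solved by the conjugate gradient method applied to $M^TMz=M^T\sigma$ from $z=0$ without matrix-matrix products, at a cost of $O(n^2\kappa(M)\log(\|\sigma\|/\mu))$ arithmetic operations. - In IF-QIPM the system is solved, after embedding in a Hermitian system, by a block-encoding-based quantum linear system algorithm (QLSA) of cost $O\big(\kappa(M)\|M\|_F\,\mathrm{polylog}(n\kappa(M)\|\sigma\|/\mu)\big)$ per run, and a classical solution is extracted by a quantum tomography algorithm (QTA) of complexity $O(n\kappa(M)\|\sigma\|/\mu)$; the cost per iteration is the product of the two, plus $O(n^2)$ classical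 operations. Iterative refinement method with fixed $\hat\zeta=10^{-2}$ and final target $\zeta=2^{-O(L)}$: solve $(A,b,c)$ to precision $\hat\zeta$, giving $(x^1,y^1,s^1)$; while $(x^k,y^k,s^k)$ is not $\zeta$-optimal (i.e. $(x^k)^Ts^k/n>\zeta$), set $\nabla^k=1/((x^k)^Ts^k)$, solve to precision $\hat\zeta$ the refining pair $\min\nabla^k(s^k)^T\hat x$ s.t. $A\hat x=0,\ \hat x\ge-\nabla^kx^k$; $\max-\nabla^k(x^k)^T\hat s$ s.t. $A^T\hat y+\hat s=\nabla^ks^k,\ \hat s\ge0$ (after the change of variables $\hat x'=\hat x+\nabla^kx^k$, started from $(\nabla^kx^0,\nabla^k(y^0-y^k),\nabla^ks^0)$), and set $x^{k+1}=x^k+\hat x^k/\nabla^k$, $y^{k+1}=y^k+\hat y^k/\nabla^k$, $s^{k+1}=c-A^Ty^{k+1}$.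
   Formalization: The limited-precision solver stops when the duality gap x^T s (not x^T s/n) is at most 10^{-2}, since the refinement may otherwise loop forever for n>100; and the bound ω on the iterates is taken to be at least 1. *)

(* Defs.v *)
From mathcomp Require Import all_boot all_order all_algebra fingroup perm.
From mathcomp Require Import mathcomp_extra boolp classical_sets reals exp.

Set Implicit Arguments.
Unset Strict Implicit.
Unset Printing Implicit Defensive.

Import Order.TTheory GRing.Theory Num.Theory.
Local Open Scope classical_set_scope.
Local Open Scope ring_scope.

Section Norms.
Variable R : realType.

(* For a column vector this is the Euclidean norm. *)
Definition normF m n (M : 'M[R]_(m, n)) : R :=
  Num.sqrt (\sum_(i < m) \sum_(j < n) M i j ^+ 2).

Definition opnorm m n (M : 'M[R]_(m, n)) : R :=
  sup [set normF (M *m v) | v in [set v : 'cV[R]_n | normF v <= 1]].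

(* Moore-Penrose inverse of a matrix of full row rank; it is invmx M when M is
   square and nonsingular. *)
Definition pinv m n (M : 'M[R]_(m, n)) : 'M[R]_(n, m) :=
  M^T *m invmx (M *m M^T).

(* The ratio of the extreme singular values, for M of full row rank. *)
Definition kappa m n (M : 'M[R]_(m, n)) : R := opnorm M * opnorm (pinv M).

(* The logarithm occurring in cost bounds and in polylogarithmic factors: shifted
   so that it is at least 1 at every x >= 0. Without the shift a bound such as
   O(log(|sigma|/mu)) would be negative, since |sigma| < mu along the method. *)
Definition lg (x : R) : R := ln (2 + x) / ln 2.

Definition dot n (u v : 'cV[R]_n) : R := (u^T *m v) 0 0.

End Norms.

Section LinearOptimization.
Variable R : realType.

Record lo m n := LO {
  lo_A : 'M[R]_(m, n);
  lo_b : 'cV[R]_m;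
  lo_c : 'cV[R]_n }.

Record triple m n := Triple {
  px : 'cV[R]_n;
  py : 'cV[R]_m;
  ps : 'cV[R]_n }.

Definition primal_feasible m n (P : lo m n) (x : 'cV[R]_n) : Prop :=
  lo_A P *m x = lo_b P /\ forall i, 0 <= x i 0.

Definition dual_feasible m n (P : lo m n) (y : 'cV[R]_m) (s : 'cV[R]_n) : Prop :=
  (lo_A P)^T *m y + s = lo_c P /\ forall i, 0 <= s i 0.

Definition feasible m n (P : lo m n) (z : triple m n) : Prop :=
  primal_feasible P (px z) /\ dual_feasible P (py z) (ps z).

Definition optimal m n (P : lo m n) (z : triple m n) : Prop :=
  [/\ feasible P z,
      forall x, primal_feasible P x -> dot (lo_c P) (px z) <= dot (lo_c P) x &
      forall y s, dual_feasible P y s -> dot (lo_b P) y <= dot (lo_b P) (py z)].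

Definition gap m n (z : triple m n) : R := dot (px z) (ps z).

Definition mu m n (z : triple m n) : R := gap z / n%:R.

(* The vector X s. *)
Definition compl m n (z : triple m n) : 'cV[R]_n :=
  \col_i (px z i 0 * ps z i 0).

Definition nbhd m n (theta : R) (P : lo m n) (z : triple m n) : Prop :=
  [/\ feasible P z,
      forall i, 0 < px z i 0, forall i, 0 < ps z i 0 &
      normF (compl z - const_mx (mu z)) <= theta * mu z].

Definition lo_of_int m n (A : 'M[int]_(m, n)) (b : 'cV[int]_m)
    (c : 'cV[int]_n) : lo m n :=
  LO (map_mx intr A) (map_mx intr b) (map_mx intr c).

End LinearOptimization.

(* up_log 2 (k + 1) is the ceiling of the binary logarithm of k + 1. *)
Definition input_length m n (A : 'M[int]_(m, n)) (b : 'cV[int]_m)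
    (c : 'cV[int]_n) : nat :=
  (m * n + m + n
   + \sum_(i < m) \sum_(j < n) up_log 2 (absz (A i j) + 1)
   + \sum_(j < n) up_log 2 (absz (c j 0%R) + 1)
   + \sum_(i < m) up_log 2 (absz (b i 0%R) + 1))%N.

Section OrthogonalSubspaces.
Variables (R : realType) (m p : nat).
Local Notation n := (m + p)%N.

(* The permutation bas moves the basic columns of A to the front:
   col_perm bas A = [A_B A_N]. *)
Definition A_B (A : 'M[R]_(m, n)) (bas : 'S_n) : 'M[R]_m :=
  lsubmx (col_perm bas A).

Definition A_N (A : 'M[R]_(m, n)) (bas : 'S_n) : 'M[R]_(m, p) :=
  rsubmx (col_perm bas A).

(* The rows are put back in the original order of the variables, so that
   A *m Vmat A bas = 0. *)
Definition Vmat (A : 'M[R]_(m, n)) (bas : 'S_n) : 'M[R]_(n, p) :=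
  row_perm bas^-1%g (col_mx (invmx (A_B A bas) *m A_N A bas) (- 1%:M)).

Definition Qmat (A : 'M[R]_(m, n)) (bas : 'S_n) : 'M[R]_(m + p, n + n) :=
  block_mx A 0 0 (Vmat A bas)^T.

Definition Mmat (A : 'M[R]_(m, n)) (bas : 'S_n) (z : triple R m n) : 'M[R]_n :=
  row_mx (- (diag_mx (px z)^T *m A^T)) (diag_mx (ps z)^T *m Vmat A bas).

Definition eta : R := 1 / 10.
Definition beta : R := 1 - 11 / 100 / Num.sqrt n%:R.

Definition sigma (z : triple R m n) : 'cV[R]_n :=
  const_mx (beta * mu z) - compl z.

End OrthogonalSubspaces.

Section ConjugateGradient.
Variables (R : realType) (n : nat).

(* Conjugate gradients for M^T M z = M^T sigma from z = 0; the state is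
   (iterate, residual of the normal equations, search direction). *)
Definition cg_step (M : 'M[R]_n) (st : 'cV[R]_n * 'cV[R]_n * 'cV[R]_n) :=
  let: (z, r, d) := st in
  let Md := M *m d in
  let a := dot r r / dot Md Md in
  let r' := r - a *: (M^T *m Md) in
  (z + a *: d, r', r' + (dot r' r' / dot r r) *: d).

Definition cg_iterate (M : 'M[R]_n) (sig : 'cV[R]_n) (j : nat) : 'cV[R]_n :=
  (iter j (cg_step M) (0, M^T *m sig, M^T *m sig)).1.1.

Definition cg_output (M : 'M[R]_n) (sig : 'cV[R]_n) (tol : R) (z : 'cV[R]_n) :=
  exists j : nat,
    [/\ z = cg_iterate M sig j,
        normF (M *m z - sig) <= tol &
        forall i, (i < j)%N -> tol < normF (M *m cg_iterate M sig i - sig)].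

End ConjugateGradient.

Section Solvers.
Variables (R : realType) (n : nat).

(* The first two arguments identify the call (refinement round and iteration
   within the round), as a tomography run need not be reproducible; then come
   the matrix, the right-hand side and the current value of mu. *)
Definition solver := nat -> nat -> 'M[R]_n -> 'cV[R]_n -> R -> 'cV[R]_n.
Definition solver_cost := nat -> nat -> 'M[R]_n -> 'cV[R]_n -> R -> R.

Definition cgm_spec (a : R) (sol : solver) (cost : solver_cost) : Prop :=
  forall r k (M : 'M[R]_n) (sig : 'cV[R]_n) (nu : R), M \in unitmx -> 0 < nu ->
    cg_output M sig (eta R * nu) (sol r k M sig nu) /\
    0 <= cost r k M sig nu
      <= a * (n%:R ^+ 2 * kappa M * lg (normF sig / nu)).

Definition quantum_spec (a : R) (d : nat) (sol : solver)
    (qlsa qta : solver_cost) : Prop :=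
  forall r k (M : 'M[R]_n) (sig : 'cV[R]_n) (nu : R), M \in unitmx -> 0 < nu ->
    [/\ normF (M *m sol r k M sig nu - sig) <= eta R * nu,
        0 <= qlsa r k M sig nu
          <= a * (kappa M * normF M * lg (n%:R * kappa M * normF sig / nu) ^+ d) &
        0 <= qta r k M sig nu <= a * (n%:R * kappa M * (normF sig / nu))].

Definition classical_spec (a : R) (cls : nat -> nat -> R) : Prop :=
  forall r k, 0 <= cls r k <= a * n%:R ^+ 2.

End Solvers.

Section IterativeRefinement.
Variables (R : realType) (m p : nat).
Local Notation n := (m + p)%N.
Variable bas : 'S_n.
Variable sol : solver R n.

Definition ipm_step (P : lo R m n) (r k : nat) (z : triple R m n) : triple R m n :=
  let A := lo_A P in
  let dz := sol r k (Mmat A bas z) (sigma z) (mu z) in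
  let dy := usubmx dz in
  let lam := dsubmx dz in
  Triple (px z + Vmat A bas *m lam) (py z + dy) (ps z - A^T *m dy).

(* The iterates t 0, ..., t K of the limited-precision solver on the problem P
   from z0 in round r; precision prec is reached when the duality gap x^T s is
   at most prec. Testing x^T s / n <= prec instead would make the refinement
   stall for n > 100: if mu z0 <= 1/100 and gap z0 >= 1, every round would
   return its own starting point. *)
Definition ipm_run (prec : R) (P : lo R m n) (r : nat) (z0 : triple R m n)
    (t : nat -> triple R m n) (K : nat) : Prop :=
  [/\ t 0%N = z0,
      forall k, (k < K)%N -> prec < gap (t k) /\ t k.+1 = ipm_step P r k (t k) &
      gap (t K) <= prec].

Definition zeta_hat : R := 1 / 100.

Definition nabla (w : triple R m n) : R := (gap w)^-1.

(* The refining pair at w in the variable x' = xhat + nabla x^k, which satisfies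
   A x' = nabla A x^k and x' >= 0. Its dual objective, nabla (A x^k)^T yhat,
   differs from -nabla (x^k)^T shat by a constant. *)
Definition refining (P : lo R m n) (w : triple R m n) : lo R m n :=
  LO (lo_A P) (nabla w *: (lo_A P *m px w)) (nabla w *: ps w).

Definition refining_start (z0 w : triple R m n) : triple R m n :=
  Triple (nabla w *: px z0) (nabla w *: (py z0 - py w)) (nabla w *: ps z0).

(* zr is the solution of the refining pair in the variables (x', yhat, shat). *)
Definition refined (P : lo R m n) (w zr : triple R m n) : triple R m n :=
  let xhat := px zr - nabla w *: px w in
  let y' := py w + (nabla w)^-1 *: py zr in
  Triple (px w + (nabla w)^-1 *: xhat) y' (lo_c P - (lo_A P)^T *m y').

(* ir_outer r is the outer iterate number r + 1; round 0 solves the problem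
   itself and round r + 1 the refining pair at ir_outer r. *)
Record ir_trace := IRTrace {
  ir_rounds : nat;
  ir_outer : nat -> triple R m n;
  ir_inner : nat -> nat -> triple R m n;
  ir_iters : nat -> nat }.

Definition ir_run (P : lo R m n) (z0 : triple R m n) (zeta : R) (tr : ir_trace) :
    Prop :=
  [/\ ipm_run zeta_hat P 0 z0 (ir_inner tr 0) (ir_iters tr 0) /\
      ir_outer tr 0 = ir_inner tr 0 (ir_iters tr 0),
      forall r, (r < ir_rounds tr)%N ->
        let w := ir_outer tr r in
        [/\ zeta < mu w,
            ipm_run zeta_hat (refining P w) r.+1 (refining_start z0 w)
              (ir_inner tr r.+1) (ir_iters tr r.+1) &
            ir_outer tr r.+1 =
              refined P w (ir_inner tr r.+1 (ir_iters tr r.+1))] &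
      mu (ir_outer tr (ir_rounds tr)) <= zeta].

Definition ir_result (tr : ir_trace) : triple R m n :=
  ir_outer tr (ir_rounds tr).

(* Iterates of the refining problems are included. *)
Definition bounds_iterates (omega : R) (tr : ir_trace) : Prop :=
  forall r, (r <= ir_rounds tr)%N ->
    [/\ normF (px (ir_outer tr r)) <= omega,
        normF (ps (ir_outer tr r)) <= omega &
        forall k, (k <= ir_iters tr r)%N ->
          normF (px (ir_inner tr r k)) <= omega /\
          normF (ps (ir_inner tr r k)) <= omega].

(* it_cost r k z : iteration k of round r, at the iterate z;
   ref_cost r    : setting up round r and updating the outer iterate;
   rnd_cost z    : final rounding of z. *)
Definition total_cost (it_cost : nat -> nat -> triple R m n -> R)
    (ref_cost : nat -> R) (rnd_cost : triple R m n -> R) (tr : ir_trace) : R :=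
  \sum_(r < (ir_rounds tr).+1)
     (ref_cost r
      + \sum_(k < ir_iters tr r) it_cost r k (ir_inner tr r k))
  + rnd_cost (ir_result tr).

End IterativeRefinement.

Section Costs.
Variables (R : realType) (m p : nat).
Local Notation n := (m + p)%N.

Definition call_cost (A : 'M[R]_(m, n)) (bas : 'S_n) (cost : solver_cost R n)
    (r k : nat) (z : triple R m n) : R :=
  cost r k (Mmat A bas z) (sigma z) (mu z).

Definition cgm_it_cost (A : 'M[R]_(m, n)) (bas : 'S_n) (cgm : solver_cost R n)
    (cls : nat -> nat -> R) (r k : nat) (z : triple R m n) : R :=
  call_cost A bas cgm r k z + cls r k.

Definition quantum_it_cost (A : 'M[R]_(m, n)) (bas : 'S_n)
    (qlsa qta : solver_cost R n) (cls : nat -> nat -> R) (r k : nat)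
    (z : triple R m n) : R :=
  call_cost A bas qlsa r k z * call_cost A bas qta r k z + cls r k.

Definition refinement_spec (a : R) (ref_cost : nat -> R) : Prop :=
  forall r, 0 <= ref_cost r <= a * n%:R ^+ 2.

(* The standard rounding procedure: exact from mu <= zeta on, and strongly
   polynomial, with O(n^3) arithmetic operations. *)
Definition rounding_spec (a : R) (P : lo R m n) (zeta : R)
    (rnd : triple R m n -> triple R m n) (rnd_cost : triple R m n -> R) : Prop :=
  forall z, feasible P z -> mu z <= zeta ->
    optimal P (rnd z) /\ 0 <= rnd_cost z <= a * n%:R ^+ 3.

(* zeta = 2^(-O(L)), with q the constant of the O. *)
Definition ir_setting (theta : R) (q : nat) (A : 'M[int]_(m, n))
    (b : 'cV[int]_m) (c : 'cV[int]_n) (bas : 'S_n) (z0 : triple R m n)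
    (zeta : R) : Prop :=
  [/\ (0 < n)%N,
      row_free (map_mx intr A : 'M[R]_(m, n)),
      A_B (map_mx intr A : 'M[R]_(m, n)) bas \in unitmx,
      nbhd theta (lo_of_int R A b c) z0 &
      2^-1 ^+ (q * input_length A b c) <= zeta].

End Costs.

(* Main.v *)
Require Import Defs.
From mathcomp Require Import all_boot all_order all_algebra fingroup perm.
From mathcomp Require Import mathcomp_extra boolp classical_sets reals exp.
From mathcomp Require Import ring lra.

Set Implicit Arguments.
Unset Strict Implicit.
Unset Printing Implicit Defensive.

Import Order.TTheory GRing.Theory Num.Theory.
Local Open Scope ring_scope.

(** Why the bounds hold.

    One iteration.  Write [u = V lam] and [v = - A^T dy] for the primal and dual
    directions.  Since [A V = 0] they are orthogonal, and the residual of the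
    linear system only perturbs the linearized complementarity.  Hence the gap is
    multiplied by [beta] up to a relative error of [eta / sqrt n], and the new
    iterate stays in the neighbourhood because the second-order term [u_i v_i] is
    controlled by [normF_hadamard].  The outcome is [ipm_step_contract]: every
    iteration multiplies [mu] by at most [1 - 1 / (100 sqrt n)].

    Conditioning.  The system matrix factors as [-X S] times [Q^T]
    ([Mmat_factor]), so its norm is at most of order [omega |Q|]; the same
    orthogonality, applied in the metric scaled by [(XS)^(-1/2)], bounds it below
    by [mu / omega] times [Q^T].  Therefore [kappa M] is at most of order
    [omega^2 kappa_Q / mu] ([kappa_Mmat]).

    One round.  An iteration at the parameter [mu] costs at most of order
    [n^2 Pi / mu + n^2], where [Pi] gathers [kappa_Q], [omega] and, for the
    quantum solver, [|Q|] and polylogarithms.  As [1 / mu] can be as large as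
    [100 n], multiplying the cost of the worst iteration by the number of
    iterations would give [n^(7/2) L].  However, [mu] decreases geometrically, so
    the sum of [1 / mu] over a round is dominated by its last term and is of order
    [n sqrt n], without the factor [L] ([geometric_sum_inv]).  Since [n <= L],
    the product [n^2 * n sqrt n] is at most [n^(5/2) L].

    All rounds.  A refinement round squares the gap ([refined_feasible]), so
    after [r] rounds it is below [2^(-2^r)] and only a logarithmic number in [L]
    of rounds is needed ([rounds_lg]).  A round may start from a gap larger than
    the initial one by [nabla^2], that is by at most [2^O(L)], so that it takes
    of the order of [sqrt n L log mu0] iterations; this only matters for the
    [n^2] term.  The two complexity bounds are the instances of
    [refinement_complexity] given by the cost per iteration of the two solvers,
    [quantum_it_cost_le] and [cgm_it_cost_le]. *)

(** * Euclidean and operator norms *)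

Section EuclideanNorm.
Variable R : realType.

Lemma dotE n (u v : 'cV[R]_n) : dot u v = \sum_i u i 0 * v i 0.
Proof. by rewrite /dot mxE; apply: eq_bigr => i _; rewrite mxE. Qed.

Lemma dotC n (u v : 'cV[R]_n) : dot u v = dot v u.
Proof. by rewrite !dotE; apply: eq_bigr => i _; rewrite mulrC. Qed.

Lemma dotDl n (u v w : 'cV[R]_n) : dot (u + v) w = dot u w + dot v w.
Proof. by rewrite /dot linearD /= mulmxDl mxE. Qed.

Lemma dotZl n k (u w : 'cV[R]_n) : dot (k *: u) w = k * dot u w.
Proof. by rewrite /dot linearZ /= -scalemxAl mxE. Qed.

Lemma dotNl n (u w : 'cV[R]_n) : dot (- u) w = - dot u w.
Proof. by rewrite -scaleN1r dotZl mulN1r. Qed.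

Lemma dotDr n (u v w : 'cV[R]_n) : dot w (u + v) = dot w u + dot w v.
Proof. by rewrite dotC dotDl !(dotC w). Qed.

Lemma dotZr n k (u w : 'cV[R]_n) : dot w (k *: u) = k * dot w u.
Proof. by rewrite dotC dotZl (dotC w). Qed.

Lemma dotNr n (u w : 'cV[R]_n) : dot w (- u) = - dot w u.
Proof. by rewrite dotC dotNl (dotC w). Qed.

Lemma dot_mulmx m n (M : 'M[R]_(m, n)) u v : dot (M *m u) v = dot u (M^T *m v).
Proof. by rewrite /dot trmx_mul mulmxA. Qed.

Lemma normF_ge0 m n (M : 'M[R]_(m, n)) : 0 <= normF M.
Proof. exact: sqrtr_ge0. Qed.

Lemma sqr_normF m n (M : 'M[R]_(m, n)) :
  normF M ^+ 2 = \sum_i \sum_j M i j ^+ 2.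
Proof.
by rewrite sqr_sqrtr// sumr_ge0// => i _; rewrite sumr_ge0// => j _; exact: sqr_ge0.
Qed.

Lemma sqr_normF_cV n (v : 'cV[R]_n) : normF v ^+ 2 = dot v v.
Proof.
by rewrite sqr_normF dotE; apply: eq_bigr => i _; rewrite big_ord1 expr2.
Qed.

Lemma dot_ge0 n (v : 'cV[R]_n) : 0 <= dot v v.
Proof. by rewrite -sqr_normF_cV sqr_ge0. Qed.

Lemma normF0 m n : normF (0 : 'M[R]_(m, n)) = 0.
Proof.
apply/eqP; rewrite -sqrf_eq0 sqr_normF; apply/eqP.
by rewrite big1// => i _; rewrite big1// => j _; rewrite mxE expr0n.
Qed.

Lemma normF_eq0 n (v : 'cV[R]_n) : normF v = 0 -> v = 0.
Proof.
move=> v0; have := sqr_normF_cV v; rewrite v0 expr0n /= dotE => /esym/eqP.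
rewrite psumr_eq0; last by move=> i _; rewrite -expr2 sqr_ge0.
move=> /allP h; apply/matrixP => i j; rewrite ord1 mxE.
by have := h i (mem_index_enum i); rewrite mulf_eq0 orbb => /eqP.
Qed.

Lemma normF_tr m n (M : 'M[R]_(m, n)) : normF M^T = normF M.
Proof.
rewrite /normF exchange_big /=; congr Num.sqrt.
by apply: eq_bigr => i _; apply: eq_bigr => j _; rewrite mxE.
Qed.

Lemma normFZ n k (v : 'cV[R]_n) : normF (k *: v) = `|k| * normF v.
Proof.
apply/eqP; rewrite -(@eqrXn2 _ 2)//; last by rewrite mulr_ge0 ?normF_ge0.
  by rewrite exprMn real_normK ?num_real// !sqr_normF_cV dotZl dotZr mulrA expr2.
exact: normF_ge0.
Qed.

Lemma cauchy_schwarz n (u v : 'cV[R]_n) : `|dot u v| <= normF u * normF v.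
Proof.
rewrite -(@ler_pXn2r _ 2) ?nnegrE//; last by rewrite mulr_ge0 ?normF_ge0.
rewrite real_normK ?num_real// exprMn !sqr_normF_cV.
have [v0|v0] := eqVneq (dot v v) 0.
  have -> : v = 0 by apply/normF_eq0/eqP; rewrite -sqrf_eq0 sqr_normF_cV v0.
  by rewrite -(scale0r 0) !dotZr !mul0r expr0n mulr0.
have vp : 0 < dot v v by rewrite lt_neqAle eq_sym v0 dot_ge0.
have := dot_ge0 (dot v v *: u - dot u v *: v).
rewrite !(dotDl, dotDr, dotNl, dotNr, dotZl, dotZr) (dotC v u) => h.
rewrite -subr_ge0 -(pmulr_rge0 _ vp); move: h; congr (0 <= _); ring.
Qed.

Lemma normFD n (u v : 'cV[R]_n) : normF (u + v) <= normF u + normF v.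
Proof.
rewrite -(@ler_pXn2r _ 2) ?nnegrE ?addr_ge0 ?normF_ge0//.
rewrite sqrrD !sqr_normF_cV dotDl !dotDr (dotC v u).
have := le_trans (ler_norm _) (cauchy_schwarz u v).
by move: (dot u v) (normF u * _) (dot u u) (dot v v) => *; lra.
Qed.

Lemma normF_entry n (v : 'cV[R]_n) i : `|v i 0| <= normF v.
Proof.
rewrite -(@ler_pXn2r _ 2) ?nnegrE ?normF_ge0// real_normK ?num_real//.
rewrite sqr_normF_cV dotE (bigD1 i)//= -expr2 lerDl sumr_ge0// => j _.
by rewrite -expr2 sqr_ge0.
Qed.

Lemma sqr_normF_col m n (M : 'M[R]_(m, n)) :
  normF M ^+ 2 = \sum_j normF (col j M) ^+ 2.
Proof.
rewrite sqr_normF exchange_big /=; apply: eq_bigr => j _.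
by rewrite sqr_normF_cV dotE; apply: eq_bigr => i _; rewrite !mxE expr2.
Qed.

Lemma normF_mulmx_cV m n (M : 'M[R]_(m, n)) (v : 'cV[R]_n) :
  normF (M *m v) <= normF M * normF v.
Proof.
rewrite -(@ler_pXn2r _ 2) ?nnegrE ?mulr_ge0 ?normF_ge0//.
rewrite exprMn sqr_normF_cV dotE -(normF_tr M) (sqr_normF_col M^T) mulr_suml.
apply: ler_sum => i _; rewrite -exprMn -expr2.
have -> : (M *m v) i 0 = dot (col i M^T) v.
  by rewrite dotE mxE; apply: eq_bigr => j _; rewrite !mxE.
by rewrite -real_normK ?num_real// lerXn2r ?nnegrE ?mulr_ge0 ?normF_ge0 ?cauchy_schwarz.
Qed.

End EuclideanNorm.

Section OperatorNorm.
Variable R : realType.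

Let has_sup_opnorm m n (M : 'M[R]_(m, n)) :
  has_sup [set normF (M *m v) | v in [set v : 'cV[R]_n | normF v <= 1]]%classic.
Proof.
split; first by exists (normF (M *m (0 : 'cV[R]_n))), 0 => //=; rewrite normF0.
exists (normF M) => _ [v /= v1 <-]; apply: le_trans (normF_mulmx_cV _ _) _.
by rewrite ler_piMr ?normF_ge0.
Qed.

Lemma opnorm_ge0 m n (M : 'M[R]_(m, n)) : 0 <= opnorm M.
Proof.
apply: le_trans (normF_ge0 (M *m (0 : 'cV[R]_n))) _.
by apply: (sup_upper_bound (has_sup_opnorm M)); exists 0 => //=; rewrite normF0.
Qed.

Lemma normF_mulmx m n (M : 'M[R]_(m, n)) (v : 'cV[R]_n) :
  normF (M *m v) <= opnorm M * normF v.
Proof.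
have [v0|v0] := eqVneq (normF v) 0.
  by rewrite v0 (normF_eq0 v0) mulmx0 normF0 mulr0.
have vp : 0 < normF v by rewrite lt_neqAle eq_sym v0 normF_ge0.
rewrite -ler_pdivrMr//.
apply: (sup_upper_bound (has_sup_opnorm M)).
exists ((normF v)^-1 *: v) => /=.
  by rewrite normFZ ger0_norm ?invr_ge0 ?normF_ge0// mulVf.
by rewrite -scalemxAr normFZ ger0_norm ?invr_ge0 ?normF_ge0// mulrC.
Qed.

Lemma opnorm_le m n (M : 'M[R]_(m, n)) B : 0 <= B ->
  (forall v : 'cV[R]_n, normF (M *m v) <= B * normF v) -> opnorm M <= B.
Proof.
move=> B0 MB; apply: ge_sup; first by case: (has_sup_opnorm M).
move=> _ [v /= v1 <-]; apply: le_trans (MB v) _.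
by rewrite ler_piMr.
Qed.

Lemma opnorm_le_normF m n (M : 'M[R]_(m, n)) : opnorm M <= normF M.
Proof. by apply: opnorm_le => [|v]; rewrite ?normF_ge0// normF_mulmx_cV. Qed.

Lemma opnorm_mulmx m n p (M : 'M[R]_(m, n)) (N : 'M[R]_(n, p)) :
  opnorm (M *m N) <= opnorm M * opnorm N.
Proof.
apply: opnorm_le => [|v]; first by rewrite mulr_ge0 ?opnorm_ge0.
rewrite -mulmxA -mulrA (le_trans (normF_mulmx _ _))//.
by rewrite ler_wpM2l ?opnorm_ge0 ?normF_mulmx.
Qed.

(** Stated for [M^T] against the norm of [M] itself: from
    [|M^T v|^2 = <v, M M^T v>], Cauchy-Schwarz and one application of [M]. *)
Lemma normF_tr_mulmx m n (M : 'M[R]_(m, n)) (v : 'cV[R]_m) :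
  normF (M^T *m v) <= opnorm M * normF v.
Proof.
have [v0|v0] := eqVneq (normF (M^T *m v)) 0.
  by rewrite v0 mulr_ge0 ?opnorm_ge0 ?normF_ge0.
have vp : 0 < normF (M^T *m v) by rewrite lt_neqAle eq_sym v0 normF_ge0.
rewrite -(ler_pM2r vp) -expr2 sqr_normF_cV dot_mulmx trmxK.
apply: le_trans (ler_norm _) _; apply: le_trans (cauchy_schwarz _ _) _.
by rewrite mulrAC mulrC ler_wpM2r ?normF_ge0// normF_mulmx.
Qed.

Lemma normF_mulmx_le m n p (M : 'M[R]_(m, n)) (N : 'M[R]_(n, p)) :
  normF (M *m N) <= opnorm M * normF N.
Proof.
rewrite -(@ler_pXn2r _ 2) ?nnegrE ?mulr_ge0 ?normF_ge0 ?opnorm_ge0//.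
rewrite exprMn !sqr_normF_col mulr_sumr; apply: ler_sum => j _.
rewrite -exprMn lerXn2r ?nnegrE ?mulr_ge0 ?normF_ge0 ?opnorm_ge0//.
by rewrite !colE -mulmxA normF_mulmx.
Qed.

Lemma entry_le_opnorm m n (M : 'M[R]_(m, n)) i j : `|M i j| <= opnorm M.
Proof.
have e1 : normF (delta_mx j 0 : 'cV[R]_n) <= 1.
  rewrite -(@ler_pXn2r _ 2) ?nnegrE ?normF_ge0// sqr_normF_cV expr1n dotE.
  rewrite (bigD1 j)//= big1 => [|k kj]; rewrite !mxE ?eqxx ?mul1r ?addr0//.
  by rewrite (negPf kj) mul0r.
apply: le_trans (_ : normF (M *m delta_mx j 0 : 'cV[R]_m) <= _).
  by apply: le_trans (normF_entry _ i); rewrite -colE mxE.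
by apply: le_trans (normF_mulmx _ _) _; rewrite ler_piMr ?opnorm_ge0.
Qed.

End OperatorNorm.
(** * Orthogonality of the two search directions *)

Section OrthogonalDecomposition.
Variables (R : realType) (m p : nat).
Local Notation n := (m + p)%N.
Variables (A : 'M[R]_(m, n)) (bas : 'S_n).
Hypothesis A_free : row_free A.
Hypothesis A_B_unit : A_B A bas \in unitmx.

Lemma mulmx_Vmat : A *m Vmat A bas = 0.
Proof.
rewrite /Vmat mul_row_perm invgK -[col_perm _ _]hsubmxK mul_row_col.
by rewrite mulmxA mulmxV// mul1mx mulmxN mulmx1 subrr.
Qed.

Lemma Vmat_inj (lam : 'cV[R]_p) : Vmat A bas *m lam = 0 -> lam = 0.
Proof.
rewrite /Vmat row_permE -mulmxA => /(congr1 (mulmx (perm_mx bas))).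
rewrite mulmxA -perm_mxM mulgV perm_mx1 mul1mx mulmx0 mul_col_mx mulNmx mul1mx.
by move=> /(congr1 dsubmx); rewrite col_mxKd linear0 => /eqP; rewrite oppr_eq0 => /eqP.
Qed.

Lemma orthogonal_directions (y : 'cV[R]_m) (lam : 'cV[R]_p) :
  dot (A^T *m y) (Vmat A bas *m lam) = 0.
Proof. by rewrite dot_mulmx trmxK mulmxA mulmx_Vmat mul0mx /dot mulmx0 mxE. Qed.

Lemma trmxA_inj (y : 'cV[R]_m) : A^T *m y = 0 -> y = 0.
Proof.
move=> /(congr1 trmx); rewrite trmx_mul trmxK trmx0 => yA.
by apply: trmx_inj; apply: (row_free_inj A_free); rewrite yA trmx0 mul0mx.
Qed.

Lemma MmatE (z : triple R m n) (w : 'cV[R]_n) i :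
  (Mmat A bas z *m w) i 0 =
  ps z i 0 * (Vmat A bas *m dsubmx w) i 0 - px z i 0 * (A^T *m usubmx w) i 0.
Proof.
rewrite -[w in LHS]vsubmxK /Mmat mul_row_col mxE addrC mulNmx -!mulmxA.
by rewrite [in X in X + _]mul_diag_mx mxE [in X in _ + X]mul_diag_mx !mxE.
Qed.

End OrthogonalDecomposition.

(** * Componentwise products of orthogonal vectors *)

Section Hadamard.
Variable R : realType.

Lemma sum_sqr_le (I : finType) (f : I -> R) : (forall i, 0 <= f i) ->
  \sum_i f i ^+ 2 <= (\sum_i f i) ^+ 2.
Proof.
move=> f0; rewrite [leRHS]expr2 mulr_suml; apply: ler_sum => i _.
by rewrite expr2 ler_wpM2l// (bigD1 i)//= lerDl sumr_ge0.
Qed.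

(** By polarization, [u_i v_i] is a quarter of the difference of the squares of
    the entries of [u + v] and [u - v], two vectors of equal norm [N].  The square
    of a difference of nonnegative numbers is at most the sum of their squares,
    which yields [N^4 / 8] for the sum of the [(u_i v_i)^2]; the constant [2 / 5]
    is a rational upper bound of [1 / sqrt 8]. *)
Lemma normF_hadamard n (u v : 'cV[R]_n) : dot u v = 0 ->
  normF (\col_i (u i 0 * v i 0)) <= 2 / 5 * normF (u + v) ^+ 2.
Proof.
move=> uv0; rewrite -(@ler_pXn2r _ 2) ?nnegrE ?normF_ge0//; last first.
  by rewrite mulr_ge0 ?sqr_ge0//; lra.
set N := normF (u + v) ^+ 2.
pose f (w : 'cV[R]_n) i := (w i 0) ^+ 2 / 4.
have fE w : \sum_i f w i = normF w ^+ 2 / 4.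
  by rewrite sqr_normF_cV dotE mulr_suml; apply: eq_bigr => i _; rewrite /f expr2.
have uvN : normF (u - v) ^+ 2 = N.
  rewrite /N !sqr_normF_cV !(dotDl, dotDr, dotNl, dotNr) (dotC v u) uv0; ring.
have f0 w i : 0 <= f w i by rewrite mulr_ge0 ?sqr_ge0//; lra.
have := sum_sqr_le (f0 (u + v)); have := sum_sqr_le (f0 (u - v)).
rewrite !fE uvN -/N => h1 h2.
rewrite sqr_normF; apply: le_trans (_ : \sum_i (f (u - v) i ^+ 2 + f (u + v) i ^+ 2) <= _).
  apply: ler_sum => i _; rewrite big_ord1 !mxE.
  have -> : u i 0 * v i 0 = f (u + v) i - f (u - v) i by rewrite /f !mxE; field.
  by have := mulr_ge0 (f0 (u + v) i) (f0 (u - v) i); nra.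
rewrite big_split /=; have := sqr_ge0 N; nra.
Qed.

(** Dividing the [i]-th linearized complementarity equation by [sqrt (x_i s_i)]
    makes the cross terms sum to twice the inner product of [u] and [v], which
    vanishes.  The left-hand side is the squared norm of the pair [(u, v)] in the
    scaled metric; it serves both the neighbourhood and the conditioning. *)
Lemma normF_weighted n (x s u v : 'cV[R]_n) g : 0 < g ->
  (forall i, 0 < x i 0) -> (forall i, 0 < s i 0) ->
  (forall i, g <= x i 0 * s i 0) -> dot u v = 0 ->
  \sum_i (s i 0 / x i 0 * u i 0 ^+ 2 + x i 0 / s i 0 * v i 0 ^+ 2)
    <= normF (\col_i (s i 0 * u i 0 + x i 0 * v i 0)) ^+ 2 / g.
Proof.
move=> g0 x0 s0 xs uv.
have uv2 : \sum_i 2 * (u i 0 * v i 0) = 0 by rewrite -mulr_sumr -dotE uv mulr0.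
rewrite -[leLHS]addr0 -[X in _ + X]uv2 -big_split /=.
rewrite sqr_normF mulr_suml; apply: ler_sum => i _; rewrite big_ord1 !mxE.
have xi := x0 i; have si := s0 i.
have -> : s i 0 / x i 0 * u i 0 ^+ 2 + x i 0 / s i 0 * v i 0 ^+ 2
          + 2 * (u i 0 * v i 0)
   = (s i 0 * u i 0 + x i 0 * v i 0) ^+ 2 / (x i 0 * s i 0).
  by field; rewrite !gt_eqF.
by rewrite ler_wpM2l ?sqr_ge0// lef_pV2 ?posrE ?mulr_gt0.
Qed.

(** The scaling [u_i -> c_i u_i], [v_i -> v_i / c_i] changes neither the
    componentwise products nor the orthogonality. *)
Lemma normF_hadamard_weighted n (x s u v : 'cV[R]_n) g : 0 < g ->
  (forall i, 0 < x i 0) -> (forall i, 0 < s i 0) ->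
  (forall i, g <= x i 0 * s i 0) -> dot u v = 0 ->
  normF (\col_i (u i 0 * v i 0))
    <= 2 / 5 * (normF (\col_i (s i 0 * u i 0 + x i 0 * v i 0)) ^+ 2 / g).
Proof.
move=> g0 x0 s0 xs uv.
pose c i := Num.sqrt (s i 0 / x i 0).
have c0 i : 0 < c i by rewrite sqrtr_gt0 divr_gt0.
have c2 i : c i ^+ 2 = s i 0 / x i 0 by rewrite sqr_sqrtr// ltW// divr_gt0.
pose u' : 'cV[R]_n := \col_i (c i * u i 0); pose v' : 'cV[R]_n := \col_i (v i 0 / c i).
have u'v' i : u' i 0 * v' i 0 = u i 0 * v i 0.
  by rewrite !mxE; field; rewrite gt_eqF.
have uv' : dot u' v' = 0.
  by rewrite -uv !dotE; apply: eq_bigr => i _; rewrite u'v'.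
have -> : \col_i (u i 0 * v i 0) = \col_i (u' i 0 * v' i 0).
  by apply/matrixP => i j; rewrite [LHS]mxE [RHS]mxE u'v'.
apply: le_trans (normF_hadamard uv') _; rewrite ler_wpM2l//; first by lra.
apply: le_trans (normF_weighted g0 x0 s0 xs uv).
rewrite sqr_normF_cV dotDl !dotDr (dotC v' u') uv' addr0 add0r !dotE -big_split /=.
apply: ler_sum => i _; rewrite !mxE lerD//.
  by rewrite -expr2 exprMn c2.
by rewrite -expr2 expr_div_n c2 invf_div mulrC.
Qed.

End Hadamard.
(** * One inexact interior-point step *)

Lemma sqrt_nat_ge1 (R : realType) n : (0 < n)%N -> 1 <= Num.sqrt n%:R :> R.
Proof. by move=> n0; rewrite -{1}(sqrtr1 R) ler_wsqrtr// ler1n. Qed.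

(** If both new coordinates were negative, the linearized term would be below
    [- 2 x s].  This replaces the usual continuity argument along the segment
    from the old iterate to the new one. *)
Lemma step_stays_positive (R : realType) (x s dx ds : R) : 0 < x -> 0 < s ->
  0 < (x + dx) * (s + ds) -> - (2 * (x * s)) < s * dx + x * ds ->
  0 < x + dx /\ 0 < s + ds.
Proof.
move=> x0 s0 prod lin; have [x'0|x'0|x'0] := ltrgtP 0 (x + dx).
- by split=> //; move: prod; rewrite pmulr_rgt0.
- have s'0 : s + ds < 0 by move: prod; rewrite nmulr_rgt0.
  have h1 : s * (x + dx) < 0 by rewrite pmulr_rlt0.
  have h2 : x * (s + ds) < 0 by rewrite pmulr_rlt0.
  by exfalso; move: h1 h2 lin; rewrite !mulrDr (mulrC s x); lra.
- by move: prod; rewrite -x'0 mul0r ltxx.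
Qed.

Section InexactStep.
Variables (R : realType) (m p : nat).
Local Notation n := (m + p)%N.
Variables (theta : R) (P : lo R m n) (bas : 'S_n).
Hypothesis n_gt0 : (0 < n)%N.
Hypothesis A_free : row_free (lo_A P).
Hypothesis A_B_unit : A_B (lo_A P) bas \in unitmx.
Hypothesis theta_bnd : 2 / 10 <= theta <= 3 / 10.

Let nR_gt0 : 0 < n%:R :> R. Proof. by rewrite ltr0n. Qed.
Let sn_ge1 : 1 <= Num.sqrt n%:R :> R.
Proof. exact: sqrt_nat_ge1. Qed.
Let sqr_sn : Num.sqrt n%:R ^+ 2 = n%:R :> R.
Proof. by rewrite sqr_sqrtr// ler0n. Qed.

Lemma sum_compl (z : triple R m n) : \sum_i compl z i 0 = gap z.
Proof. by rewrite /gap dotE; apply: eq_bigr => i _; rewrite mxE. Qed.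

Lemma gapE (z : triple R m n) : gap z = n%:R * mu z.
Proof. by rewrite /mu mulrC divfK// gt_eqF. Qed.

Lemma nbhd_mu_gt0 (z : triple R m n) : nbhd theta P z -> 0 < mu z.
Proof.
move=> [_ x0 s0 _]; rewrite /mu divr_gt0// /gap dotE.
have h i : 0 <= px z i 0 * ps z i 0 by rewrite ltW// mulr_gt0.
rewrite lt_neqAle eq_sym sumr_ge0// andbT psumr_neq0//.
by apply/hasP; exists (Ordinal n_gt0); rewrite ?mem_index_enum// mulr_gt0.
Qed.

Lemma nbhd_compl_ge (z : triple R m n) : nbhd theta P z ->
  forall i, (1 - theta) * mu z <= px z i 0 * ps z i 0.
Proof.
move=> [_ _ _ h] i; have := le_trans (normF_entry _ i) h.
by rewrite !mxE ler_norml => /andP[+ _]; lra.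
Qed.

Lemma dot_const (c : R) (v : 'cV[R]_n) : dot (const_mx c) v = c * \sum_i v i 0.
Proof. by rewrite dotE mulr_sumr; apply: eq_bigr => i _; rewrite mxE. Qed.

Lemma normF_const (c : R) : normF (const_mx c : 'cV[R]_n) ^+ 2 = n%:R * c ^+ 2.
Proof.
rewrite sqr_normF_cV dot_const (eq_bigr (fun=> c)); last by move=> i _; rewrite mxE.
by rewrite sumr_const card_ord -mulr_natr; ring.
Qed.

(** The centrality error is orthogonal to the all-ones vector, so the reduction
    of the target from [mu] to [beta mu] adds exactly [(11 / 100)^2 mu^2] to its
    squared norm, whatever [n].  For [theta >= 2 / 10] the square root of
    [theta^2 + (11 / 100)^2] is at most [theta + 29 / 1000]. *)
Lemma normF_sigma (z : triple R m n) : nbhd theta P z ->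
  normF (sigma z) <= (theta + 29 / 1000) * mu z.
Proof.
move=> zN; have mu0 := nbhd_mu_gt0 zN; case: zN => _ _ _ h.
have [th1 th2] := andP theta_bnd.
rewrite -(@ler_pXn2r _ 2) ?nnegrE ?normF_ge0//; last by rewrite mulr_ge0 ?ltW//; lra.
pose e := compl z - const_mx (mu z).
have -> : sigma z = const_mx (beta R m p * mu z - mu z) - e.
  by apply/matrixP => i j; rewrite !mxE; ring.
have e1 : \sum_i e i 0 = 0.
  rewrite (eq_bigr (fun i => compl z i 0 - mu z)); last by move=> i _; rewrite !mxE.
  by rewrite big_split /= sum_compl sumr_const card_ord -mulr_natl mulrN -gapE subrr.
rewrite sqr_normF_cV dotDl !dotDr !(dotNl, dotNr) (dotC e (const_mx _)).
rewrite !(dot_const _ e) e1 mulr0 oppr0 addr0 add0r opprK -!sqr_normF_cV normF_const.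
have -> : n%:R * (beta R m p * mu z - mu z) ^+ 2 = (11 / 100) ^+ 2 * mu z ^+ 2.
  rewrite /beta; move: sqr_sn sn_ge1; set t := Num.sqrt _ => <- t1.
  by field; rewrite gt_eqF// (lt_le_trans _ t1).
have : normF e ^+ 2 <= (theta * mu z) ^+ 2.
  by rewrite ler_pXn2r ?nnegrE ?normF_ge0// (le_trans (normF_ge0 _) h).
have := sqr_ge0 (mu z); nra.
Qed.

(** All that the convergence analysis needs from either solver. *)
Definition accurate (sol : solver R n) := forall r k M sig nu,
  M \in unitmx -> 0 < nu -> normF (M *m sol r k M sig nu - sig) <= eta R * nu.

(** A kernel vector would give orthogonal directions of norm zero in the scaled
    metric of [normF_weighted]. *)
Lemma Mmat_unit (z : triple R m n) : nbhd theta P z ->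
  Mmat (lo_A P) bas z \in unitmx.
Proof.
move=> zN; have mu0 := nbhd_mu_gt0 zN; have cg := nbhd_compl_ge zN.
case: zN => _ x0 s0 _; have [th1 th2] := andP theta_bnd.
have g0 : 0 < (1 - theta) * mu z by rewrite mulr_gt0//; lra.
rewrite -unitmx_tr -row_free_unit -kermx_eq0; apply/eqP/row_matrixP => i.
rewrite row0; set w := row i _.
have wM : w *m (Mmat (lo_A P) bas z)^T = 0.
  by apply/sub_kermxP; exact: row_sub.
have {wM} Mw : Mmat (lo_A P) bas z *m w^T = 0.
  by apply: trmx_inj; rewrite trmx_mul trmxK wM trmx0.
have := MmatE (lo_A P) bas z w^T; rewrite Mw => MwE.
set u := Vmat (lo_A P) bas *m dsubmx w^T in MwE.
set v := (lo_A P)^T *m usubmx w^T in MwE.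
have uv : dot u (- v) = 0.
  by rewrite dotNr dotC orthogonal_directions ?oppr0.
have := normF_weighted g0 x0 s0 cg uv.
have -> : \col_i (ps z i 0 * u i 0 + px z i 0 * (- v) i 0) = 0.
  apply/matrixP => j k; rewrite [LHS]mxE [(- v) _ _]mxE mulrN -MwE.
  by rewrite !mxE.
rewrite normF0 expr0n /= mul0r => h.
have term j : 0 <= ps z j 0 / px z j 0 * u j 0 ^+ 2 /\
              0 <= px z j 0 / ps z j 0 * (- v) j 0 ^+ 2.
  by split; rewrite mulr_ge0 ?sqr_ge0// ltW// divr_gt0.
have /eqP := le_anti (introT andP (conj h (sumr_ge0 _ (fun j _ =>
  let: conj a b := term j in addr_ge0 a b)))).
rewrite psumr_eq0; last by move=> j _; have [a b] := term j; exact: addr_ge0.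
move=> /allP z0.
have uv0 j : u j 0 = 0 /\ v j 0 = 0.
  have := z0 j (mem_index_enum j); have [a b] := term j.
  rewrite paddr_eq0// !mulf_eq0 !invr_eq0 !(gt_eqF (x0 j)) !(gt_eqF (s0 j)) /=.
  by rewrite !orbb [(- v) j 0]mxE oppr_eq0 => /andP[/eqP-> /eqP->].
have u0 : u = 0 by apply/matrixP => j k; rewrite ord1 [RHS]mxE; case: (uv0 j).
have v0 : v = 0 by apply/matrixP => j k; rewrite ord1 [RHS]mxE; case: (uv0 j).
apply: trmx_inj; rewrite trmx0 -[w^T]vsubmxK.
by rewrite (Vmat_inj u0) (trmxA_inj A_free v0) col_mx0.
Qed.

Lemma mean_le_normF (v : 'cV[R]_n) :
  `|(\sum_i v i 0) / n%:R| * Num.sqrt n%:R <= normF v.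
Proof.
have n1 : normF (const_mx 1 : 'cV[R]_n) = Num.sqrt n%:R.
  by rewrite -[LHS]ger0_norm ?normF_ge0// -sqrtr_sqr normF_const expr1n mulr1.
have := cauchy_schwarz (const_mx 1) v; rewrite n1 dot_const mul1r => cs.
rewrite normrM normfV (ger0_norm (ltW nR_gt0)).
rewrite -(ler_pM2l (lt_le_trans ltr01 sn_ge1)); apply: le_trans cs.
by rewrite mulrCA -expr2 sqr_sn divfK// gt_eqF.
Qed.

Lemma normF_center (v : 'cV[R]_n) :
  normF (v - const_mx ((\sum_i v i 0) / n%:R)) <= normF v.
Proof.
set rho := _ / _.
have cv : dot (const_mx rho) v = n%:R * rho ^+ 2.
  by rewrite dot_const expr2 /rho mulrCA; congr (_ * _); rewrite mulrC divfK// gt_eqF.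
rewrite -(@ler_pXn2r _ 2) ?nnegrE ?normF_ge0// !sqr_normF_cV dotDl !dotDr.
rewrite !(dotNl, dotNr) (dotC v (const_mx _)) cv -[dot (const_mx _) _]sqr_normF_cV.
rewrite normF_const; have := mulr_ge0 (ltW nR_gt0) (sqr_ge0 rho); lra.
Qed.

Let theta_ineq :
  2 / 5 * (theta + 129 / 1000) ^+ 2 <= (79 / 100 * theta - 1 / 10) * (1 - theta).
Proof.
have [th1 th2] := andP theta_bnd.
have : 0 <= (theta - 2 / 10) * (3 / 10 - theta) by rewrite mulr_ge0; lra.
by rewrite expr2; lra.
Qed.

Variable sol : solver R n.
Hypothesis sol_acc : accurate sol.

(** The new complementarity vector is [beta mu + res + h], with [res] the residual
    and [h] the product of the directions, whose entries sum to zero.  Averaging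
    gives the decrease of [mu]; subtracting the average leaves the centred
    residual, of norm at most [mu / 10], and [h], which [theta_ineq] bounds by
    what the smaller neighbourhood of the new iterate allows. *)
Lemma ipm_step_contract r k (z : triple R m n) : nbhd theta P z ->
  nbhd theta P (ipm_step bas sol P r k z) /\
  mu (ipm_step bas sol P r k z) <= (1 - 1 / 100 / Num.sqrt n%:R) * mu z.
Proof.
move=> zN; have mu0 := nbhd_mu_gt0 zN; have cg := nbhd_compl_ge zN.
have nsig := normF_sigma zN.
have [th1 th2] := andP theta_bnd.
have g0 : 0 < (1 - theta) * mu z by rewrite mulr_gt0//; lra.
have := sol_acc r k (sigma z) (Mmat_unit zN) mu0.
set z' := ipm_step _ _ _ _ _ _.
set dz := sol _ _ _ _ _; set res := _ - sigma z => res_le.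
case: zN => [[[Axb x_ge0] [Aysc s_ge0]] x0 s0 _].
pose dx := Vmat (lo_A P) bas *m dsubmx dz.
pose ds := - ((lo_A P)^T *m usubmx dz).
have xz' : px z' = px z + dx by [].
have sz' : ps z' = ps z + ds by [].
have dxds : dot dx ds = 0 by rewrite dotNr dotC orthogonal_directions ?oppr0.
pose w : 'cV[R]_n := \col_i (ps z i 0 * dx i 0 + px z i 0 * ds i 0).
have wE : w = Mmat (lo_A P) bas z *m dz.
  apply/matrixP => i j; rewrite ord1 MmatE mxE -/dx; congr (_ + _).
  by rewrite /ds [X in _ * X]mxE mulrN.
have w_res : w = res + sigma z by rewrite wE /res subrK.
pose h : 'cV[R]_n := \col_i (dx i 0 * ds i 0).
have sum_h : \sum_i h i 0 = 0.
  by rewrite -[RHS]dxds dotE; apply: eq_bigr => i _; rewrite mxE.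
have wi i : w i 0 = beta R m p * mu z - px z i 0 * ps z i 0 + res i 0.
  have -> : res i 0 = w i 0 - (sigma z) i 0 by rewrite wE /res [LHS]mxE [X in _ + X]mxE.
  rewrite [sigma z i 0]mxE [const_mx _ _ _]mxE [(- compl z) _ _]mxE.
  by rewrite [compl _ _ _]mxE; ring.
clearbody res.
have addE (a1 a2 : 'cV[R]_n) i : (a1 + a2) i 0 = a1 i 0 + a2 i 0 by rewrite mxE.
have oppE (a1 : 'cV[R]_n) i : (- a1) i 0 = - a1 i 0 by rewrite mxE.
have cstE (c : R) i : (const_mx c : 'cV[R]_n) i 0 = c by rewrite mxE.
have compE i : compl z' i 0 = (px z i 0 + dx i 0) * (ps z i 0 + ds i 0).
  by rewrite mxE xz' sz' [X in X * _]mxE [X in _ * X]mxE.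
have ci i : compl z' i 0 = beta R m p * mu z + res i 0 + h i 0.
  rewrite compE; have -> : h i 0 = dx i 0 * ds i 0 by rewrite mxE.
  have -> : res i 0 = w i 0 - (beta R m p * mu z - px z i 0 * ps z i 0).
    by rewrite wi; ring.
  by rewrite [w i 0]mxE; ring.
pose rho := (\sum_i res i 0) / n%:R.
have rhoE : \sum_i res i 0 = n%:R * rho by rewrite /rho mulrC divfK// gt_eqF.
have muE : mu z' = beta R m p * mu z + rho.
  rewrite {1}/mu -sum_compl; under eq_bigr do rewrite ci.
  rewrite !big_split /= sum_h addr0.
  rewrite (sumr_const _ (beta R m p * mu z)) card_ord -(mulr_natl (_ * _)) mulrDl.
  by rewrite mulrAC mulfV ?gt_eqF// mul1r.
have rho_le : `|rho| * Num.sqrt n%:R <= normF res by exact: mean_le_normF.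
set t := Num.sqrt n%:R in rho_le.
have t1 : 1 <= t by exact: sn_ge1.
have t0 : 0 < t by rewrite (lt_le_trans _ t1).
have ti : 0 < t^-1 <= 1 by rewrite invr_gt0 t0 invf_le1.
have rho_bnd : `|rho| <= 1 / 10 * (t^-1 * mu z).
  rewrite mulrCA -ler_pdivrMl ?invr_gt0// invrK mulrC; apply: le_trans rho_le _.
  by move: res_le; rewrite /eta.
have betaE : beta R m p = 1 - 11 / 100 * t^-1 by [].
have [ti0 ti1] := andP ti.
have tmu : 0 < t^-1 * mu z <= mu z.
  by rewrite mulr_gt0//= ler_piMl// ltW.
have [tm0 tm1] := andP tmu.
have [rho1 rho2] : - (1 / 10 * (t^-1 * mu z)) <= rho /\ rho <= 1 / 10 * (t^-1 * mu z).
  by move: rho_bnd; rewrite ler_norml => /andP.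
have th0 : 0 <= theta by lra.
have th07 : 7 / 10 <= 1 - theta by lra.
(* beta -+ eta / sqrt n is 1 - (11/100 +- 10/100) / sqrt n *)
have mu_up : mu z' <= (1 - 1 / 100 / t) * mu z.
  by rewrite muE betaE; lra.
have mu_lo : 79 / 100 * mu z <= mu z'.
  by rewrite muE betaE; lra.
have hw : normF h <= 2 / 5 * (normF w ^+ 2 / ((1 - theta) * mu z)).
  exact: normF_hadamard_weighted.
have w_le : normF w <= (theta + 129 / 1000) * mu z.
  by rewrite w_res; apply: le_trans (normFD _ _) _; move: res_le nsig; rewrite /eta; lra.
have c25 : 0 <= 2 / 5 :> R by rewrite divr_ge0.
have h_le : normF h <= (79 / 100 * theta - 1 / 10) * mu z.
  apply: le_trans hw _; rewrite mulrA ler_pdivrMr//.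
  have : normF w ^+ 2 <= ((theta + 129 / 1000) * mu z) ^+ 2.
    by rewrite ler_pXn2r ?nnegrE ?normF_ge0// (le_trans (normF_ge0 _) w_le).
  move=> /(ler_wpM2l c25) /le_trans; apply.
  rewrite exprMn mulrA; apply: le_trans (ler_wpM2r (sqr_ge0 (mu z)) theta_ineq) _.
  by rewrite le_eqVlt; apply/orP; left; apply/eqP; ring.
have rr : normF (res - const_mx rho) <= normF res by exact: normF_center.
have near : normF (compl z' - const_mx (mu z')) <= theta * mu z'.
  have -> : compl z' - const_mx (mu z') = (res - const_mx rho) + h.
    by apply/matrixP => i j; rewrite ord1 !addE !oppE !cstE ci muE; ring.
  apply: le_trans (normFD _ _) _; move: res_le; rewrite /eta => res_le'.
  have := ler_wpM2l th0 mu_lo.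
  move: (normF res) (normF h) (normF (_ - _)) h_le rr res_le' => nr nh nd.
  lra.
have mu'0 : 0 < mu z' by apply: lt_le_trans mu_lo; rewrite mulr_gt0// divr_gt0.
(* by near-centrality every product is at least 1 - theta times the new mu *)
have c'0 i : 0 < (px z i 0 + dx i 0) * (ps z i 0 + ds i 0).
  have := le_trans (normF_entry _ i) near; rewrite addE oppE cstE -compE.
  have h1 : 0 < (1 - theta) * mu z' by rewrite mulr_gt0// (lt_le_trans _ th07)// divr_gt0.
  by rewrite ler_norml => /andP[+ _]; move: h1; rewrite mulrBl mul1r; lra.
have pos i : 0 < px z' i 0 /\ 0 < ps z' i 0.
  rewrite xz' sz' !addE; apply: step_stays_positive => //.
  have := wi i; rewrite [w i 0]mxE => ->.
  have := le_trans (normF_entry res i) res_le; rewrite ler_norml => /andP[re _].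
  have xs : 0 < px z i 0 * ps z i 0 by rewrite mulr_gt0.
  move: re xs tm1 mu0; rewrite betaE /eta mulrBl mul1r -mulrA.
  lra.
split=> //; split=> //; last 2 first.
- by move=> i; case: (pos i).
- by move=> i; case: (pos i).
split; split.
- by rewrite xz' mulmxDr Axb /dx mulmxA mulmx_Vmat// mul0mx addr0.
- by move=> i; apply: ltW; case: (pos i).
- rewrite sz' /z' /ipm_step /= mulmxDr -Aysc -/dz /ds.
  set a1 := _ *m py z; set a2 := _ *m usubmx _.
  by rewrite addrACA subrr addr0.
- by move=> i; apply: ltW; case: (pos i).
Qed.

End InexactStep.
(** * Condition number of the system matrix *)

Section FullRowRank.
Variables (R : realType) (k l : nat) (M : 'M[R]_(k, l)).
Hypothesis M_free : row_free M.

(** Over the reals, [w M M^T = 0] forces [|M^T w^T|^2 = 0]. *)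
Lemma gram_unit : M *m M^T \in unitmx.
Proof.
rewrite -row_free_unit -kermx_eq0; apply/eqP/row_matrixP => i; rewrite row0.
set w := row i _; have wM : w *m (M *m M^T) = 0.
  by apply/sub_kermxP; exact: row_sub.
have : dot (M^T *m w^T) (M^T *m w^T) = 0.
  have MMw : M *m M^T *m w^T = 0.
    by apply: trmx_inj; rewrite !trmx_mul !trmxK wM trmx0.
  by rewrite dot_mulmx trmxK mulmxA MMw /dot mulmx0 mxE.
rewrite -sqr_normF_cV => /eqP; rewrite sqrf_eq0 => /eqP /normF_eq0 h.
apply: (row_free_inj M_free); rewrite mul0mx.
by apply: trmx_inj; rewrite trmx_mul trmx0.
Qed.

Lemma mulmx_pinv : M *m pinv M = 1%:M.
Proof. by rewrite /pinv mulmxA mulmxV ?gram_unit. Qed.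

(** The reciprocal of [opnorm (pinv M)] is the least singular value of [M]. *)
Lemma normF_le_pinv (v : 'cV[R]_k) :
  normF v <= opnorm (pinv M) * normF (M^T *m v).
Proof.
rewrite -{1}[v]mul1mx -trmx1 -mulmx_pinv trmx_mul -mulmxA.
exact: normF_tr_mulmx.
Qed.

Lemma kappa_ge1 : (0 < k)%N -> 1 <= kappa M.
Proof.
move=> k0; rewrite /kappa; apply: le_trans (opnorm_mulmx _ _).
rewrite mulmx_pinv; apply: le_trans (entry_le_opnorm _ (Ordinal k0) (Ordinal k0)).
by rewrite mxE eqxx normr1.
Qed.

End FullRowRank.

Lemma pinv_unitmx (R : realType) n (M : 'M[R]_n) : M \in unitmx -> pinv M = invmx M.
Proof.
move=> Mu; have Mf : row_free M by rewrite row_free_unit.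
by rewrite -[LHS]mul1mx -(mulVmx Mu) -mulmxA mulmx_pinv// mulmx1.
Qed.

Section Conditioning.
Variables (R : realType) (m p : nat).
Local Notation n := (m + p)%N.
Variables (A : 'M[R]_(m, n)) (bas : 'S_n).
Hypothesis A_free : row_free A.
Local Notation Q := (Qmat A bas).

Lemma tr_Qmat_mul (w : 'cV[R]_n) :
  Q^T *m w = col_mx (A^T *m usubmx w) (Vmat A bas *m dsubmx w).
Proof.
rewrite -[w in LHS]vsubmxK tr_block_mx trmxK !trmx0 mul_block_col.
by rewrite !mul0mx addr0 add0r.
Qed.

Lemma Qmat_free : row_free Q.
Proof.
rewrite -kermx_eq0; apply/eqP/row_matrixP => i; rewrite row0.
set w := row i _; have wQ : w *m Q = 0 by apply/sub_kermxP; exact: row_sub.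
have : Q^T *m w^T = 0 by rewrite -trmx_mul wQ trmx0.
rewrite tr_Qmat_mul => h; apply: trmx_inj; rewrite trmx0 -[w^T]vsubmxK.
have := congr1 usubmx h; rewrite col_mxKu linear0 => /(trmxA_inj A_free)->.
have := congr1 dsubmx h; rewrite col_mxKd linear0 => /Vmat_inj->.
by rewrite col_mx0.
Qed.

Lemma Mmat_factor (z : triple R m n) :
  Mmat A bas z = row_mx (- diag_mx (px z)^T) (diag_mx (ps z)^T) *m Q^T.
Proof.
by rewrite tr_block_mx trmxK !trmx0 mul_row_block !mulmx0 addr0 add0r mulNmx.
Qed.

Lemma normF_diag (x : 'cV[R]_n) : normF (diag_mx x^T) ^+ 2 = normF x ^+ 2.
Proof.
rewrite sqr_normF sqr_normF_cV dotE; apply: eq_bigr => i _.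
rewrite (bigD1 i)//= big1 => [|j ji]; rewrite !mxE.
  by rewrite eqxx mulr1n addr0 expr2.
by rewrite eq_sym (negPf ji) mulr0n expr0n.
Qed.

Lemma normF_row_mx k l1 l2 (M1 : 'M[R]_(k, l1)) (M2 : 'M[R]_(k, l2)) :
  normF (row_mx M1 M2) ^+ 2 = normF M1 ^+ 2 + normF M2 ^+ 2.
Proof.
rewrite !sqr_normF -big_split /=; apply: eq_bigr => i _.
rewrite big_split_ord /=; congr (_ + _); apply: eq_bigr => j _.
  by rewrite row_mxEl.
by rewrite row_mxEr.
Qed.

Lemma normF_col_mx l1 l2 (u : 'cV[R]_l1) (v : 'cV[R]_l2) :
  normF (col_mx u v) ^+ 2 = normF u ^+ 2 + normF v ^+ 2.
Proof. by rewrite -normF_tr tr_col_mx normF_row_mx !normF_tr. Qed.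

(** Using the Frobenius norm of [-X S], which is the Euclidean norm of the pair
    [(x, s)], avoids a factor [sqrt n]. *)
Lemma normF_Mmat (z : triple R m n) omega :
  normF (px z) <= omega -> normF (ps z) <= omega ->
  normF (Mmat A bas z) <= 2 * omega * opnorm Q.
Proof.
move=> xo so; have o0 : 0 <= omega := le_trans (normF_ge0 _) xo.
rewrite Mmat_factor -normF_tr trmx_mul trmxK.
apply: le_trans (normF_mulmx_le _ _) _; rewrite mulrC ler_wpM2r ?opnorm_ge0//.
rewrite normF_tr -(@ler_pXn2r _ 2) ?nnegrE ?normF_ge0 ?mulr_ge0//.
rewrite normF_row_mx.
have -> : normF (- diag_mx (px z)^T) ^+ 2 = normF (px z) ^+ 2.
  rewrite -normF_diag !sqr_normF; apply: eq_bigr => i _; apply: eq_bigr => j _.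
  by rewrite [in LHS]mxE sqrrN.
rewrite normF_diag.
have := lerXn2r 2 (normF_ge0 (px z)) o0 xo.
have := lerXn2r 2 (normF_ge0 (ps z)) o0 so.
by rewrite exprMn; have := sqr_ge0 omega; lra.
Qed.

Hypothesis A_B_unit : A_B A bas \in unitmx.

(** Each ratio [s_i / x_i] and [x_i / s_i] is at least [g / omega^2], so the
    scaled metric of [normF_weighted] dominates the Euclidean one. *)
Lemma normF_tr_Qmat_le (z : triple R m n) omega g (w : 'cV[R]_n) :
  (forall i, 0 < px z i 0) -> (forall i, 0 < ps z i 0) -> 0 < g ->
  (forall i, g <= px z i 0 * ps z i 0) ->
  normF (px z) <= omega -> normF (ps z) <= omega ->
  g * normF (Q^T *m w) <= omega * normF (Mmat A bas z *m w).
Proof.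
move=> x0 s0 g0 xs xo so; have o0 : 0 <= omega := le_trans (normF_ge0 _) xo.
set u := Vmat A bas *m dsubmx w; set v := A^T *m usubmx w.
have uv : dot u (- v) = 0 by rewrite dotNr dotC orthogonal_directions ?oppr0.
have := normF_weighted g0 x0 s0 xs uv.
have -> : \col_i (ps z i 0 * u i 0 + px z i 0 * (- v) i 0) = Mmat A bas z *m w.
  apply/matrixP => i j; rewrite ord1 MmatE mxE; congr (_ + _).
  by rewrite [X in _ * X]mxE mulrN.
rewrite ler_pdivlMr// => h.
rewrite -(@ler_pXn2r _ 2) ?nnegrE ?mulr_ge0 ?normF_ge0// ?(ltW g0)// !exprMn.
rewrite tr_Qmat_mul normF_col_mx -/u -/v.
apply: le_trans (ler_wpM2l (sqr_ge0 omega) h).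
rewrite expr2 -mulrA [leLHS]mulrC [leRHS]mulrA ler_pM2r//.
have ratio (a b c : R) : 0 < a -> a <= omega -> g <= a * b ->
    g * c ^+ 2 <= omega ^+ 2 * (b / a * c ^+ 2).
  move=> a0 ao gab; rewrite [leRHS]mulrA ler_wpM2r ?sqr_ge0//; apply: (le_trans gab).
  have b0 : 0 < b by rewrite -(pmulr_rgt0 b a0) (lt_le_trans g0 gab).
  have -> : a * b = a ^+ 2 * (b / a) by field; rewrite gt_eqF.
  by rewrite ler_wpM2r ?lerXn2r// ?nnegrE// ltW// divr_gt0.
rewrite !sqr_normF_cV !dotE addrC -big_split !mulr_sumr; apply: ler_sum => i _ /=.
have xi : px z i 0 <= omega := le_trans (ler_norm _) (le_trans (normF_entry _ i) xo).
have si : ps z i 0 <= omega := le_trans (ler_norm _) (le_trans (normF_entry _ i) so).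
have -> : (- v) i 0 ^+ 2 = v i 0 ^+ 2 by rewrite mxE sqrrN.
by rewrite -!expr2 mulrDr [leRHS]mulrDr lerD ?ratio// mulrC.
Qed.

Lemma kappa_Mmat (theta : R) (P : lo R m n) (z : triple R m n) omega :
  (0 < n)%N -> theta <= 3 / 10 -> lo_A P = A -> nbhd theta P z ->
  Mmat A bas z \in unitmx ->
  normF (px z) <= omega -> normF (ps z) <= omega ->
  kappa (Mmat A bas z) <= 4 * omega ^+ 2 * kappa Q / mu z.
Proof.
move=> n0 th PA zN Mu xo so; have mu0 := nbhd_mu_gt0 n0 zN.
have cg := nbhd_compl_ge zN; case: (zN) => _ x0 s0 _.
have o0 : 0 <= omega := le_trans (normF_ge0 _) xo.
have g0 : 0 < (1 - theta) * mu z by rewrite mulr_gt0//; lra.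
have inv_le : opnorm (invmx (Mmat A bas z)) <=
    opnorm (pinv Q) * omega / ((1 - theta) * mu z).
  apply: opnorm_le => [|w].
    by rewrite divr_ge0 ?(ltW g0)// mulr_ge0// opnorm_ge0.
  set v := invmx _ *m w.
  have -> : w = Mmat A bas z *m v by rewrite /v mulmxA mulmxV// mul1mx.
  apply: le_trans (normF_le_pinv Qmat_free v) _.
  rewrite -!mulrA ler_wpM2l ?opnorm_ge0// mulrCA mulrC ler_pdivlMr// mulrC.
  exact: normF_tr_Qmat_le.
rewrite /kappa pinv_unitmx//.
apply: le_trans (ler_pM (opnorm_ge0 _) (opnorm_ge0 _)
  (le_trans (opnorm_le_normF _) (normF_Mmat xo so)) inv_le) _.
rewrite invfM; set iv := (1 - theta)^-1.
have iv2 : iv <= 2 by rewrite -[leRHS]invrK lef_pV2 ?posrE; lra.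
set K := omega ^+ 2 * (opnorm Q * opnorm (pinv Q)) / mu z.
have K0 : 0 <= K by rewrite mulr_ge0 ?invr_ge0 ?(ltW mu0)// !mulr_ge0 ?sqr_ge0 ?opnorm_ge0.
have -> : 4 * omega ^+ 2 * (opnorm Q * opnorm (pinv Q)) / mu z = 2 * 2 * K.
  by rewrite /K; ring.
have -> : 2 * omega * opnorm Q * (opnorm (pinv Q) * omega * (iv / mu z)) = 2 * iv * K.
  by rewrite /K; ring.
by rewrite ler_wpM2r// ler_wpM2l.
Qed.

End Conditioning.

(** The entries of [A] are integers and [V] contains a negated identity, so that
    [Q] has an entry of absolute value at least 1.  It allows the costs without
    a factor [|Q|] to be absorbed in the quantum bound. *)
Lemma opnorm_Qmat_ge1 (R : realType) m p (A : 'M[int]_(m, m + p))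
    (bas : 'S_(m + p)) : (0 < m + p)%N ->
  row_free (map_mx intr A : 'M[R]_(m, m + p)) ->
  1 <= opnorm (Qmat (map_mx intr A : 'M[R]_(m, m + p)) bas).
Proof.
move=> n0; set AR := map_mx _ _; move=> Af.
case: (posnP p) => [p0|p0].
  have m0 : (0 < m)%N by rewrite p0 addn0 in n0.
  pose i0 := Ordinal m0.
  have [j Aj] : exists j, A i0 j != 0.
    apply/existsP; rewrite -negb_forall; apply/negP => /forallP h.
    have : (delta_mx 0 i0 : 'rV[R]_m) *m AR = 0 *m AR.
      by rewrite -rowE mul0mx; apply/rowP => j; rewrite !mxE (eqP (h j)).
    move=> /(row_free_inj Af) /matrixP /(_ 0 i0); rewrite !mxE !eqxx /= => /eqP.
    by rewrite oner_eq0.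
  apply: le_trans (entry_le_opnorm _ (lshift p i0) (lshift (m + p) j)).
  by rewrite block_mxEul mxE -intr_norm (ler_int _ 1) -gtz0_ge1 normr_gt0.
pose j0 := Ordinal p0.
pose i := bas (rshift m j0).
apply: le_trans (entry_le_opnorm _ (rshift m j0) (rshift (m + p) i)).
rewrite block_mxEdr mxE /Vmat mxE permK col_mxEd !mxE eqxx.
by rewrite normrN normr1.
Qed.
(** * Logarithms and geometrically decreasing sequences *)

Section ShiftedLog.
Variable R : realType.
Implicit Types x y : R.

Let ln2_gt0 : 0 < ln 2 :> R. Proof. by rewrite ln_gt0// ltr1n. Qed.

Lemma ler_lg x y : 0 <= x -> x <= y -> lg x <= lg y.
Proof.
move=> x0 xy; rewrite /lg ler_pM2r ?invr_gt0// ler_ln ?posrE; lra.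
Qed.

Lemma lg_ge1 x : 0 <= x -> 1 <= lg x.
Proof. by move=> x0; rewrite /lg ler_pdivlMr// mul1r ler_ln ?posrE//; lra. Qed.

Lemma lg_ge0 x : 0 <= x -> 0 <= lg x.
Proof. by move=> x0; rewrite (le_trans ler01) ?lg_ge1. Qed.

Lemma lgM x y : 0 <= x -> 0 <= y -> lg (x * y) <= lg x + lg y.
Proof.
move=> x0 y0; rewrite /lg -mulrDl ler_pM2r ?invr_gt0//.
have xy0 := mulr_ge0 x0 y0.
rewrite -lnM ?posrE ?ler_ln ?posrE ?mulr_gt0//; lra.
Qed.

Lemma ln_le_lg x : 0 < x -> ln x <= lg x.
Proof.
move=> x0; have l1 : ln 2 <= 1 :> R.
  by have := @le_ln1Dx R 1; rewrite -[1 + 1]/(2%:R); apply; lra.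
have l2 : ln x <= ln (2 + x) by rewrite ler_ln ?posrE; lra.
have l3 : 0 <= ln (2 + x) by rewrite ln_ge0//; lra.
by apply: le_trans l2 _; rewrite /lg ler_pdivlMr// ler_piMr.
Qed.

End ShiftedLog.

Section GeometricDecrease.
Variables (R : realType) (g : nat -> R) (delta prec : R) (K : nat).
Hypothesis delta_gt0 : 0 < delta.
Hypothesis delta_le1 : delta <= 1.
Hypothesis prec_gt0 : 0 < prec.
Hypothesis g_large : forall k, (k < K)%N -> prec < g k.
Hypothesis g_decr : forall k, (k < K)%N -> g k.+1 <= (1 - delta) * g k.

(** Before the last term the sequence is still above [prec], while its logarithm
    has dropped by at least [delta] at each step. *)
Lemma geometric_count B : 0 <= B -> ln (g 0%N / prec) <= B ->
  K%:R <= 1 + delta^-1 * B.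
Proof.
move=> B0 gB; case: (posnP K) => [->|K0].
  by rewrite addr_ge0// mulr_ge0// invr_ge0 ltW.
have gp k : (k < K)%N -> 0 < g k by move=> /g_large; exact: lt_trans.
have h k : (k < K)%N -> ln (g k) <= ln (g 0%N) - k%:R * delta.
  elim: k => [|k IH] kK; first by rewrite mul0r subr0.
  have kK' := ltnW kK; have d1 : 0 < 1 - delta.
    have := lt_le_trans (gp _ kK) (g_decr kK'); rewrite pmulr_lgt0//.
    exact: gp.
  apply: le_trans (_ : ln ((1 - delta) * g k) <= _).
    by rewrite ler_ln ?posrE ?mulr_gt0 ?gp// g_decr.
  rewrite lnM ?posrE ?gp//; have := IH kK'.
  have : ln (1 - delta) <= - delta by apply: le_ln1Dx; lra.
  by rewrite -natr1; lra.
have K1 : (K.-1 < K)%N by rewrite prednK.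
have := h _ K1; have : ln prec <= ln (g K.-1).
  by rewrite ler_ln ?posrE ?gp// ltW// g_large.
move: gB; rewrite ln_div ?posrE ?gp// => h1 h2 h3.
have : K.-1%:R * delta <= B by lra.
rewrite -ler_pdivlMr// -{2}(prednK K0) -natr1 addrC => h4.
by rewrite lerD2l mulrC.
Qed.

(** The inverses grow geometrically, so the last of them dominates the sum. *)
Lemma geometric_sum_inv : \sum_(k < K) (g k)^-1 <= delta^-1 * prec^-1.
Proof.
have gp k : (k < K)%N -> 0 < g k by move=> /g_large; exact: lt_trans.
suff h k : (k < K)%N -> \sum_(j < k.+1) (g j)^-1 <= delta^-1 * (g k)^-1.
  case: (posnP K) => [->|K0]; first by rewrite big_ord0 mulr_ge0 ?invr_ge0 ?ltW.
  have K1 : (K.-1 < K)%N by rewrite prednK.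
  have := h _ K1; rewrite prednK// => /le_trans; apply.
  by rewrite ler_wpM2l ?invr_ge0 ?(ltW delta_gt0)// lef_pV2 ?posrE ?gp// ltW// g_large.
elim: k => [|k IH] kK.
  have d1 : 1 <= delta^-1 by rewrite invf_ge1.
  by rewrite big_ord_recr big_ord0 /= add0r ler_peMl// invr_ge0 ltW// gp.
rewrite big_ord_recr /=; have kK' := ltnW kK.
apply: le_trans (lerD (IH kK') (lexx _)) _.
have : (g k)^-1 <= (1 - delta) * (g k.+1)^-1.
  by rewrite ler_pdivlMr ?gp// mulrC ler_pdivrMr ?gp// g_decr.
move=> /(ler_wpM2l (ltW (etrans (invr_gt0 _) delta_gt0))) /= h.
apply: le_trans (lerD h (lexx _)) _.
by rewrite mulrA mulrBr mulVf ?gt_eqF// mulr1 mulrBl mul1r subrK.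
Qed.

End GeometricDecrease.
(** * The limited-precision solver *)

Section InnerRun.
Variables (R : realType) (m p : nat).
Local Notation n := (m + p)%N.
Variables (theta : R) (P : lo R m n) (bas : 'S_n) (sol : solver R n).
Hypothesis n_gt0 : (0 < n)%N.
Hypothesis A_free : row_free (lo_A P).
Hypothesis A_B_unit : A_B (lo_A P) bas \in unitmx.
Hypothesis theta_bnd : 2 / 10 <= theta <= 3 / 10.
Hypothesis sol_acc : accurate sol.

Let delta : R := 1 / 100 / Num.sqrt n%:R.

Let sn_ge1 : 1 <= Num.sqrt n%:R :> R.
Proof. exact: sqrt_nat_ge1. Qed.

Let delta_gt0 : 0 < delta.
Proof. by rewrite divr_gt0 ?(lt_le_trans ltr01 sn_ge1)//; lra. Qed.

Let delta_le1 : delta <= 1.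
Proof.
rewrite /delta ler_pdivrMr ?(lt_le_trans ltr01 sn_ge1)//.
by have := sn_ge1; lra.
Qed.

Let deltaV : delta^-1 = 100 * Num.sqrt n%:R.
Proof. by rewrite /delta invf_div; lra. Qed.

Lemma nbhd_gap_gt0 (z : triple R m n) : nbhd theta P z -> 0 < gap z.
Proof. by move=> zN; rewrite gapE// mulr_gt0 ?ltr0n// (nbhd_mu_gt0 n_gt0 zN). Qed.

Lemma ipm_step_gap r k z : nbhd theta P z ->
  gap (ipm_step bas sol P r k z) <= (1 - delta) * gap z.
Proof.
move=> zN; rewrite !gapE// [leRHS]mulrCA ler_wpM2l//.
by have [] := ipm_step_contract n_gt0 A_free A_B_unit theta_bnd sol_acc r k zN.
Qed.

Section Run.
Variables (r : nat) (z0 : triple R m n) (t : nat -> triple R m n) (K : nat).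
Hypothesis z0N : nbhd theta P z0.
Hypothesis run : ipm_run bas sol (zeta_hat R) P r z0 t K.

Lemma ipm_run_nbhd k : (k <= K)%N -> nbhd theta P (t k).
Proof.
have [t0 step _] := run; elim: k => [|k IH] kK; first by rewrite t0.
have [_ ->] := step k kK.
by have [] := ipm_step_contract n_gt0 A_free A_B_unit theta_bnd sol_acc r k (IH (ltnW kK)).
Qed.

Lemma ipm_run_decr k : (k < K)%N -> gap (t k.+1) <= (1 - delta) * gap (t k).
Proof.
move=> kK; have [_ step _] := run; have [_ ->] := step k kK.
by apply: ipm_step_gap; apply: ipm_run_nbhd; exact: ltnW.
Qed.

Lemma ipm_run_large k : (k < K)%N -> 1 / 100 < gap (t k).
Proof. by move=> kK; have [_ step _] := run; have [] := step k kK. Qed.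

Lemma ipm_run_count B : 0 <= B -> ln (100 * gap z0) <= B ->
  K%:R <= 1 + 100 * Num.sqrt n%:R * B.
Proof.
move=> B0 gB; rewrite -deltaV.
have p0 : 0 < 1 / 100 :> R by lra.
apply: (geometric_count delta_gt0 p0 ipm_run_large ipm_run_decr B0).
by have [-> _ _] := run; rewrite mulrC invf_div divr1.
Qed.

Lemma ipm_run_sum_inv_mu :
  \sum_(k < K) (mu (t k))^-1 <= 10000 * (n%:R * Num.sqrt n%:R).
Proof.
have p0 : 0 < 1 / 100 :> R by lra.
have := geometric_sum_inv delta_gt0 delta_le1 p0 ipm_run_large ipm_run_decr.
have -> : \sum_(k < K) (mu (t k))^-1 = n%:R * \sum_(k < K) (gap (t k))^-1.
  by rewrite mulr_sumr; apply: eq_bigr => k _; rewrite /mu invf_div.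
rewrite deltaV invf_div divr1 => /(ler_wpM2l (ler0n R n)) /= h.
by apply: le_trans h _; lra.
Qed.

End Run.

Section Trajectory.
Variables (r : nat) (z0 : triple R m n).
Hypothesis z0N : nbhd theta P z0.

Fixpoint trajectory k : triple R m n :=
  if k is k'.+1 then ipm_step bas sol P r k' (trajectory k') else z0.

Lemma trajectory_nbhd k : nbhd theta P (trajectory k).
Proof.
elim: k => [|k IH] //=.
by have [] := ipm_step_contract n_gt0 A_free A_B_unit theta_bnd sol_acc r k IH.
Qed.

(** Otherwise [geometric_count] would bound every natural number. *)
Lemma trajectory_stops : exists k, gap (trajectory k) <= zeta_hat R.
Proof.
apply: contrapT => /forallNP h.
have large k : 1 / 100 < gap (trajectory k) by rewrite ltNge; apply/negP; exact: h.
have decr k : gap (trajectory k.+1) <= (1 - delta) * gap (trajectory k).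
  by apply: ipm_step_gap; exact: trajectory_nbhd.
have p0 : 0 < 1 / 100 :> R by lra.
set B := Num.max 0 (ln (gap (trajectory 0) / (1 / 100))).
have B0 : 0 <= B by rewrite le_max lexx.
have lB : ln (gap (trajectory 0) / (1 / 100)) <= B by rewrite le_max lexx orbT.
have bnd K := @geometric_count R (fun k => gap (trajectory k)) _ _ K delta_gt0 p0
  (fun k _ => large k) (fun k _ => decr k) B B0 lB.
have C0 : 0 <= 1 + delta^-1 * B by rewrite addr_ge0// mulr_ge0// invr_ge0 ltW.
by have := archi_boundP C0; rewrite ltNge bnd.
Qed.

Lemma ipm_run_exists : exists K, ipm_run bas sol (zeta_hat R) P r z0 trajectory K.
Proof.
exists (ex_minn trajectory_stops); case: ex_minnP => K gK Kmin; split=> // k kK.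
by split=> //; rewrite ltNge; apply: contraL kK => /Kmin; rewrite -leqNgt.
Qed.

End Trajectory.

End InnerRun.

(** * One refinement round *)

Section Refinement.
Variables (R : realType) (m p : nat).
Local Notation n := (m + p)%N.
Variables (theta : R) (P : lo R m n).
Hypothesis n_gt0 : (0 < n)%N.

(** The start is the initial point scaled by [nabla] in both [x] and [s], which
    scales complementarity and [mu] alike by [nabla^2]. *)
Lemma refining_start_nbhd (z0 w : triple R m n) :
  nbhd theta P z0 -> feasible P w -> 0 < gap w ->
  nbhd theta (refining P w) (refining_start z0 w).
Proof.
move=> [[[Ax x_ge0] [As s_ge0]] x0 s0 near] [[Axw _] [Asw _]] gw.
have nw : 0 < nabla w by rewrite invr_gt0.
have cE : compl (refining_start z0 w) = nabla w ^+ 2 *: compl z0.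
  by apply/matrixP => i j; rewrite !mxE; ring.
have gE : gap (refining_start z0 w) = nabla w ^+ 2 * gap z0.
  by rewrite /gap /= dotZl dotZr mulrA expr2.
have mE : mu (refining_start z0 w) = nabla w ^+ 2 * mu z0.
  by rewrite /mu gE mulrA.
split.
- split; split => /=.
  + by rewrite -scalemxAr Ax Axw.
  + by move=> i; rewrite mxE mulr_ge0// ltW.
  + rewrite -scalemxAr -scalerDr; congr (_ *: _).
    rewrite mulmxBr -[in RHS](addKr ((lo_A P)^T *m py w) (ps w)) Asw -As.
    by rewrite addrAC addrC.
  + by move=> i; rewrite mxE mulr_ge0// ltW.
- by move=> i; rewrite mxE mulr_gt0.
- by move=> i; rewrite mxE mulr_gt0.
rewrite cE mE.
have -> : const_mx (nabla w ^+ 2 * mu z0) =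
    nabla w ^+ 2 *: const_mx (mu z0) :> 'cV[R]_n.
  by apply/matrixP => i j; rewrite !mxE.
by rewrite -scalerBr normFZ ger0_norm ?sqr_ge0// mulrCA ler_wpM2l// sqr_ge0.
Qed.

(** The new outer iterate is the solution of the refining pair divided by [nabla]
    in both [x] and [s]; as [1 / nabla] is the current gap, the gap gets squared. *)
Lemma refined_feasible (w zr : triple R m n) :
  feasible P w -> 0 < gap w -> feasible (refining P w) zr ->
  feasible P (refined P w zr) /\ gap (refined P w zr) = gap w ^+ 2 * gap zr.
Proof.
move=> [[Axw _] [Asw _]] gw [[Ax x0] [As s0]] /=.
have nw : nabla w != 0 by rewrite invr_eq0 gt_eqF.
have nVE : (nabla w)^-1 = gap w by rewrite invrK.
have pxE : px (refined P w zr) = gap w *: px zr.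
  by rewrite /= nVE scalerBr scalerA mulfV ?gt_eqF// scale1r addrC subrK.
have psE : ps (refined P w zr) = gap w *: ps zr.
  rewrite /= nVE mulmxDr -scalemxAr -Asw.
  have -> : ps w = gap w *: (nabla w *: ps w).
    by rewrite scalerA mulfV ?gt_eqF// scale1r.
  rewrite /= in As; rewrite -As scalerDr; set a1 := _ *m py w; set a2 := gap w *: _.
  by rewrite opprD addrACA subrr add0r addrAC subrr add0r.
split; last by rewrite /gap pxE psE dotZl dotZr mulrA expr2.
split; split.
- rewrite pxE -scalemxAr Ax /= scalerA mulfV ?gt_eqF// scale1r.
  by [].
- by move=> i; rewrite pxE mxE mulr_ge0// ltW.
- by rewrite [ps _]/= addrC subrK.
- by move=> i; rewrite psE mxE mulr_ge0// ltW.
Qed.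

End Refinement.
(** * The whole refinement method *)

Section OuterRun.
Variables (R : realType) (m p : nat).
Local Notation n := (m + p)%N.
Variables (theta : R) (P : lo R m n) (bas : 'S_n) (sol : solver R n).
Variables (z0 : triple R m n) (zeta : R) (ell : nat).
Hypothesis n_gt0 : (0 < n)%N.
Hypothesis A_free : row_free (lo_A P).
Hypothesis A_B_unit : A_B (lo_A P) bas \in unitmx.
Hypothesis theta_bnd : 2 / 10 <= theta <= 3 / 10.
Hypothesis sol_acc : accurate sol.
Hypothesis z0N : nbhd theta P z0.
Hypothesis zeta_ge : 2^-1 ^+ ell <= zeta.

Let gap_ge_mu (z : triple R m n) : 0 < gap z -> mu z <= gap z.
Proof. by move=> gz; rewrite ler_pdivrMr ?ltr0n// ler_peMr ?ler1n// ltW. Qed.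

(** What an outer iterate must satisfy for the next refining pair to be well
    defined, together with a bound on its gap. *)
Definition round_ok (e : R) (w : triple R m n) : Prop :=
  [/\ feasible P w, 0 < gap w & gap w <= e].

Lemma first_round t K : ipm_run bas sol (zeta_hat R) P 0 z0 t K ->
  round_ok (2^-1) (t K).
Proof.
move=> run.
have tN := ipm_run_nbhd n_gt0 A_free A_B_unit theta_bnd sol_acc z0N run (leqnn K).
have [_ _] := run; rewrite /zeta_hat => gK; split; last by lra.
- by case: tN.
- exact: (nbhd_gap_gt0 n_gt0 tN).
Qed.

(** The gap is squared, and the factor [1 / 100] gained by the inner solver is
    dropped. *)
Lemma next_round e r w t K : round_ok e w ->
  ipm_run bas sol (zeta_hat R) (refining P w) r (refining_start z0 w) t K ->
  round_ok (e ^+ 2) (refined P w (t K)).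
Proof.
move=> [wF wgt0 we] run.
have sN := refining_start_nbhd z0N wF wgt0.
have tN := @ipm_run_nbhd _ _ _ _ (refining P w) _ _ n_gt0 A_free A_B_unit theta_bnd
  sol_acc _ _ _ _ sN run _ (leqnn K).
have [tF _ _ _] := tN; have [w'F gE] := refined_feasible wF wgt0 tF.
have tgt0 := nbhd_gap_gt0 n_gt0 tN.
split=> //; first by rewrite gE mulr_gt0// exprn_gt0.
rewrite gE; have [_ _] := run; rewrite /zeta_hat => gK.
apply: le_trans (_ : gap w ^+ 2 <= _).
  by rewrite ler_piMr ?sqr_ge0//; lra.
by rewrite lerXn2r ?nnegrE// ltW// (lt_le_trans wgt0).
Qed.

Lemma outer_invariant tr : ir_run bas sol P z0 zeta tr ->
  forall r, (r <= ir_rounds tr)%N -> round_ok (2^-1 ^+ (2 ^ r)) (ir_outer tr r).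
Proof.
move=> [[run0 out0] step _]; elim=> [|r IH] rN.
  by rewrite out0 expr1; exact: first_round run0.
have [_ run ->] := step r rN.
rewrite expnS mulnC exprM; apply: next_round run.
by apply: IH; exact: ltnW.
Qed.

Lemma result_feasible tr : ir_run bas sol P z0 zeta tr ->
  feasible P (ir_result tr) /\ mu (ir_result tr) <= zeta.
Proof.
move=> run; have [] := outer_invariant run (leqnn _); case: run => _ _ h.
by split.
Qed.

(** The gap is doubly exponentially small in [r], while refinement goes on only
    as long as it exceeds [2^-ell]. *)
Lemma rounds_le tr : ir_run bas sol P z0 zeta tr ->
  forall r, (r < ir_rounds tr)%N -> (2 ^ r < ell)%N.
Proof.
move=> run r rN; have [_ wgt0 we] := outer_invariant run (ltnW rN).
have [_ step _] := run; have [zw _ _] := step r rN.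
have := lt_le_trans (le_lt_trans zeta_ge zw) (le_trans (gap_ge_mu wgt0) we).
rewrite !exprVn ltf_pV2 ?posrE ?exprn_gt0// ltr_eXn2l ?ltr1n//.
Qed.

Definition round_problem (w : nat -> triple R m n) r : lo R m n :=
  if r is r'.+1 then refining P (w r') else P.

Definition round_start (w : nat -> triple R m n) r : triple R m n :=
  if r is r'.+1 then refining_start z0 (w r') else z0.

Lemma round_run tr : ir_run bas sol P z0 zeta tr ->
  forall r, (r <= ir_rounds tr)%N ->
  [/\ lo_A (round_problem (ir_outer tr) r) = lo_A P,
      nbhd theta (round_problem (ir_outer tr) r) (round_start (ir_outer tr) r) &
      ipm_run bas sol (zeta_hat R) (round_problem (ir_outer tr) r) r
        (round_start (ir_outer tr) r) (ir_inner tr r) (ir_iters tr r)].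
Proof.
move=> run [|r] rN; first by case: (run) => [[]].
have [wF wgt0 _] := outer_invariant run (ltnW rN).
case: (run) => _ /(_ r rN) [_ h _] _; split=> //=.
exact: refining_start_nbhd.
Qed.

(** The refining pair starts from the initial gap multiplied by [nabla^2], and
    [nabla <= 2^ell] as long as the method has not stopped. *)
Lemma ln_round_start tr : ir_run bas sol P z0 zeta tr ->
  forall r, (r <= ir_rounds tr)%N ->
  ln (100 * gap (round_start (ir_outer tr) r))
    <= 100 + n%:R + lg (mu z0) + 2 * ell%:R.
Proof.
move=> run; have g0 := nbhd_gap_gt0 n_gt0 z0N; have m0 := nbhd_mu_gt0 n_gt0 z0N.
have nR : 0 < n%:R :> R by rewrite ltr0n.
have base : ln (100 * gap z0) <= 100 + n%:R + lg (mu z0).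
  have nm : 0 < n%:R * mu z0 by rewrite mulr_gt0.
  rewrite gapE// lnM ?posrE//. rewrite lnM ?posrE// addrA.
  have h : ln 100 <= 100 :> R by rewrite ltW// ln_sublinear.
  by rewrite !lerD ?ln_le_lg// ltW// ln_sublinear.
case=> [|r] rN; first by apply: le_trans base _; rewrite lerDl mulr_ge0.
have [_ wgt0 _] := outer_invariant run (ltnW rN).
have [_ /(_ r rN) [zw _ _] _] := run; set w := ir_outer tr r in wgt0 zw.
have -> : gap (round_start (ir_outer tr) r.+1) = nabla w ^+ 2 * gap z0.
  by rewrite /gap /= dotZl dotZr mulrA expr2.
rewrite mulrCA lnM ?posrE ?exprn_gt0 ?mulr_gt0 ?invr_gt0// addrC lerD//.
rewrite lnXn ?invr_gt0// -(mulr_natl (ln _)) ler_wpM2l//.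
have : nabla w <= 2 ^+ ell.
  rewrite /nabla -[leRHS]invrK lef_pV2 ?posrE ?invr_gt0 ?exprn_gt0// -exprVn.
  by apply: le_trans zeta_ge _; apply: le_trans (ltW zw) (gap_ge_mu wgt0).
rewrite -(@ler_ln R) ?posrE ?invr_gt0 ?exprn_gt0// => h; apply: le_trans h _.
rewrite lnXn// -(mulr_natl (ln _)) ler_piMr//.
by have := @le_ln1Dx R 1; rewrite -[1 + 1]/(2%:R); apply; lra.
Qed.

(** [E / mu] is summed geometrically within each round, whereas the constant part
    [F] is multiplied by the number of iterations. *)
Lemma total_cost_le tr omega (it_cost : nat -> nat -> triple R m n -> R)
    (ref_cost : nat -> R) (rnd_cost : triple R m n -> R) (E F H : R) :
  0 <= E -> 0 <= F ->
  ir_run bas sol P z0 zeta tr -> bounds_iterates omega tr ->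
  (forall r k z P', lo_A P' = lo_A P -> nbhd theta P' z -> 1 / 100 < gap z ->
     normF (px z) <= omega -> normF (ps z) <= omega ->
     it_cost r k z <= E / mu z + F) ->
  (forall r, ref_cost r <= F) -> rnd_cost (ir_result tr) <= H ->
  total_cost it_cost ref_cost rnd_cost tr <=
    (ir_rounds tr).+1%:R * (F + (E * (10000 * (n%:R * Num.sqrt n%:R)) +
      F * (1 + 100 * Num.sqrt n%:R *
             (100 + n%:R + lg (mu z0) + 2 * ell%:R)))) + H.
Proof.
move=> E0 F0 run bnd itc refc rndc; rewrite /total_cost lerD//.
rewrite mulr_natl -[X in _ *+ X]card_ord -sumr_const; apply: ler_sum => -[r rN] _ /=.
rewrite lerD//; have rN' : (r <= ir_rounds tr)%N by [].
have [PA sN irun] := round_run run rN'.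
move: sN irun; set P' := round_problem _ _; set s := round_start _ _ => sN irun.
have A_free' : row_free (lo_A P') by rewrite PA.
have A_B_unit' : A_B (lo_A P') bas \in unitmx by rewrite PA.
set K := ir_iters tr r.
apply: le_trans (_ : \sum_(k < K) (E * (mu (ir_inner tr r k))^-1 + F) <= _).
  apply: ler_sum => -[k kK] _ /=.
  have [_ _ /(_ k (ltnW kK)) [xo so]] := bnd r rN'.
  have tN := ipm_run_nbhd n_gt0 A_free' A_B_unit' theta_bnd sol_acc sN irun (ltnW kK).
  exact: (itc _ _ _ _ PA tN (ipm_run_large irun kK) xo so).
rewrite big_split /= -mulr_sumr (sumr_const _ F) card_ord -(mulr_natr F) lerD//.
  rewrite ler_wpM2l//.
  exact: (ipm_run_sum_inv_mu n_gt0 A_free' A_B_unit' theta_bnd sol_acc sN irun).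
rewrite ler_wpM2l//; apply: (ipm_run_count n_gt0 A_free' A_B_unit' theta_bnd sol_acc sN irun).
  have lg0 : 0 <= lg (mu z0).
    by rewrite (le_trans ler01)// lg_ge1// ltW// (nbhd_mu_gt0 n_gt0 z0N).
  by rewrite !addr_ge0// mulr_ge0.
exact: ln_round_start.
Qed.

Section Existence.

Let run_len (P' : lo R m n) r s : nat :=
  xget 0%N [set K | ipm_run bas sol (zeta_hat R) P' r s
                      (trajectory P' bas sol r s) K]%classic.

Let run_lenP (P' : lo R m n) r s : lo_A P' = lo_A P -> nbhd theta P' s ->
  ipm_run bas sol (zeta_hat R) P' r s (trajectory P' bas sol r s) (run_len P' r s).
Proof.
move=> PA sN.
apply: (@xgetPex _ 0%N [set K | ipm_run bas sol (zeta_hat R) P' r s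
                                  (trajectory P' bas sol r s) K]%classic).
by apply: (@ipm_run_exists _ _ _ theta) => //; rewrite PA.
Qed.

Fixpoint refinement_outer r : triple R m n :=
  if r is r'.+1 then
    let w := refinement_outer r' in
    let P' := refining P w in let s := refining_start z0 w in
    refined P w (trajectory P' bas sol r s (run_len P' r s))
  else trajectory P bas sol 0 z0 (run_len P 0 z0).

Lemma refinement_outer_ok r : round_ok (2^-1 ^+ (2 ^ r)) (refinement_outer r).
Proof.
elim: r => [|r IH]; first by rewrite expr1; exact: (first_round (run_lenP 0 (erefl _) z0N)).
rewrite expnS mulnC exprM; have [wF w0 _] := IH.
have sN := refining_start_nbhd z0N wF w0.
exact: (next_round IH (@run_lenP (refining P _) r.+1 _ (erefl _) sN)).
Qed.

Lemma ir_run_exists : exists tr, ir_run bas sol P z0 zeta tr.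
Proof.
have stop : exists N, mu (refinement_outer N) <= zeta.
  (* already 2^(-2^ell) <= 2^(-ell) *)
  exists ell; have [_ w0 we] := refinement_outer_ok ell.
  apply: le_trans (gap_ge_mu w0) _; apply: le_trans we _; apply: le_trans zeta_ge.
  rewrite !exprVn lef_pV2 ?posrE ?exprn_gt0// ler_eXn2l ?ltr1n//.
  by rewrite ltnW// ltn_expl.
pose P' r := round_problem refinement_outer r.
pose s r := round_start refinement_outer r.
exists (IRTrace (ex_minn stop) refinement_outer
  (fun r => trajectory (P' r) bas sol r (s r)) (fun r => run_len (P' r) r (s r))).
case: ex_minnP => N gN Nmin; split=> //=.
  by split=> //; exact: (run_lenP 0 (erefl _) z0N).
move=> r rN; split=> //.
  by rewrite ltNge; apply: contraL rN => /Nmin; rewrite -leqNgt.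
apply: run_lenP => //; case: (refinement_outer_ok r) => wF w0 _.
exact: refining_start_nbhd.
Qed.

End Existence.

End OuterRun.
(** * Cost of one iteration *)

Section IterationCosts.
Variables (R : realType) (m p : nat).
Local Notation n := (m + p)%N.
Variables (theta a omega : R) (A : 'M[R]_(m, n)) (bas : 'S_n) (P : lo R m n).
Variable z : triple R m n.
Hypothesis n_gt0 : (0 < n)%N.
Hypothesis A_free : row_free A.
Hypothesis A_B_unit : A_B A bas \in unitmx.
Hypothesis theta_bnd : 2 / 10 <= theta <= 3 / 10.
Hypothesis a_gt0 : 0 < a.
Hypothesis omega_ge1 : 1 <= omega.
Hypothesis PA : lo_A P = A.
Hypothesis zN : nbhd theta P z.
Hypothesis x_le : normF (px z) <= omega.
Hypothesis s_le : normF (ps z) <= omega.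
Local Notation Q := (Qmat A bas).

Let mu_gt0 : 0 < mu z. Proof. exact: (nbhd_mu_gt0 n_gt0 zN). Qed.

Let M_unit : Mmat A bas z \in unitmx.
Proof.
rewrite -PA; apply: (Mmat_unit n_gt0 _ _ theta_bnd zN); by rewrite PA.
Qed.

Let kappa_le : kappa (Mmat A bas z) <= 4 * omega ^+ 2 * kappa Q / mu z.
Proof.
have [_ th] := andP theta_bnd.
exact: (kappa_Mmat A_free A_B_unit n_gt0 th PA zN M_unit x_le s_le).
Qed.

Let kappa_ge0 k l (M : 'M[R]_(k, l)) : 0 <= kappa M.
Proof. by rewrite mulr_ge0 ?opnorm_ge0. Qed.

Let sigma_le : normF (sigma z) / mu z <= 1.
Proof.
rewrite ler_pdivrMr// mul1r; apply: le_trans (normF_sigma n_gt0 theta_bnd zN) _.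
by rewrite ler_piMl ?(ltW mu_gt0)//; have [_ th] := andP theta_bnd; lra.
Qed.

Let sigma_ge0 : 0 <= normF (sigma z) / mu z.
Proof. by rewrite divr_ge0 ?normF_ge0 ?ltW. Qed.

(** The right-hand side [sigma] is smaller than [mu], so the logarithm in the cost
    of conjugate gradients is at most a constant. *)
Lemma cgm_it_cost_le sol cgm cls r k :
  cgm_spec a sol cgm -> classical_spec n a cls ->
  cgm_it_cost A bas cgm cls r k z
    <= 4 * a * lg 1 * n%:R ^+ 2 * (kappa Q * omega ^+ 2) / mu z + a * n%:R ^+ 2.
Proof.
move=> /(_ r k _ (sigma z) _ M_unit mu_gt0) [_ /andP[_ cg]] cl.
rewrite /cgm_it_cost /call_cost lerD//; last by have /andP[] := cl r k.
apply: le_trans cg _.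
have lg_le : lg (normF (sigma z) / mu z) <= lg 1 by apply: ler_lg.
have lg0 : 0 <= lg (normF (sigma z) / mu z) by rewrite (le_trans ler01) ?lg_ge1.
apply: le_trans (_ : a * (n%:R ^+ 2 * (4 * omega ^+ 2 * kappa Q / mu z) * lg 1) <= _).
  rewrite ler_wpM2l ?(ltW a_gt0)// ler_pM//; first by rewrite mulr_ge0// exprn_ge0.
  by rewrite ler_wpM2l ?exprn_ge0.
by rewrite le_eqVlt; apply/orP; left; apply/eqP; ring.
Qed.

Hypothesis gap_large : 1 / 100 < gap z.

Let mu_inv_le : (mu z)^-1 <= 100 * n%:R.
Proof.
have := gap_large; rewrite gapE// => h.
by rewrite -[leLHS]mul1r ler_pdivrMr//; lra.
Qed.

(** While the solver runs, [1 / mu] is at most [100 n], so that the argument of the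
    logarithm is at most [400 n^2 omega^2 kappa_Q]. *)
Lemma lg_condition_le :
  lg (n%:R * kappa (Mmat A bas z) * normF (sigma z) / mu z)
    <= (lg 400 + 5) * (lg n%:R * lg (kappa Q) * lg omega).
Proof.
have n0 : 0 <= n%:R :> R by [].
have k0 : 0 <= kappa Q by [].
have o0 : 0 <= omega by rewrite (le_trans ler01).
have h400 : 0 <= 400 :> R by [].
apply: le_trans (_ : lg (400 * (n%:R * n%:R) * ((omega * omega) * kappa Q)) <= _).
  apply: ler_lg; first by rewrite -mulrA mulr_ge0// mulr_ge0.
  rewrite -mulrA; apply: le_trans (_ : n%:R * kappa (Mmat A bas z) * 1 <= _).
    by rewrite ler_wpM2l// mulr_ge0.
  rewrite mulr1; apply: le_trans (ler_wpM2l n0 kappa_le) _.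
  apply: le_trans (_ : n%:R * (4 * omega ^+ 2 * kappa Q * (100 * n%:R)) <= _).
    by rewrite ler_wpM2l// ler_wpM2l// mulr_ge0// mulr_ge0// exprn_ge0.
  by rewrite le_eqVlt; apply/orP; left; apply/eqP; ring.
have l1 := lgM (mulr_ge0 h400 (mulr_ge0 n0 n0)) (mulr_ge0 (mulr_ge0 o0 o0) k0).
have l2 := lgM h400 (mulr_ge0 n0 n0); have l3 := lgM n0 n0.
have l4 := lgM (mulr_ge0 o0 o0) k0; have l5 := lgM o0 o0.
apply: le_trans (_ : lg 400 + 2 * lg n%:R + 2 * lg omega + lg (kappa Q) <= _).
  by move: l1 l2 l3 l4 l5; move: (lg _) (lg _) (lg _) => *; lra.
have x1 := lg_ge1 n0; have y1 := lg_ge1 k0; have w1 := lg_ge1 o0.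
have c1 := lg_ge1 h400.
move: (lg n%:R) (lg (kappa Q)) (lg omega) (lg 400) x1 y1 w1 c1 => x y w c x1 y1 w1 c1.
have xy1 : 1 <= x * y by rewrite mulr_ege1.
have P1 : 1 <= x * y * w by rewrite mulr_ege1.
have Px : x <= x * y * w by rewrite -mulrA ler_peMr ?mulr_ege1//; lra.
have Py : y <= x * y * w by rewrite mulrAC ler_peMl ?mulr_ege1//; lra.
have Pw : w <= x * y * w by rewrite ler_peMl//; lra.
have : c <= c * (x * y * w) by rewrite ler_peMr//; lra.
by lra.
Qed.

(** The product of the two quantum costs contains [kappa M] twice, hence
    [1 / mu^2]; one of these factors is replaced by [100 n], so that the cost has
    the same shape as that of conjugate gradients. *)
Lemma quantum_it_cost_le d sol qlsa qta cls r k :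
  quantum_spec a d sol qlsa qta -> classical_spec n a cls ->
  quantum_it_cost A bas qlsa qta cls r k z
    <= 3200 * a ^+ 2 * (lg 400 + 5) ^+ d * n%:R ^+ 2 *
         (kappa Q ^+ 2 * opnorm Q * omega ^+ 5 *
            (lg n%:R * lg (kappa Q) * lg omega) ^+ d) / mu z
       + a * n%:R ^+ 2.
Proof.
move=> /(_ r k _ (sigma z) _ M_unit mu_gt0) [_ /andP[ql0 ql] /andP[qt0 qt]] cl.
rewrite /quantum_it_cost /call_cost lerD//; last by have /andP[] := cl r k.
have o0 : 0 <= omega by rewrite (le_trans ler01).
have n0 : 0 <= n%:R :> R by [].
have K0 := kappa_ge0 (Mmat A bas z); have N0 := normF_ge0 (Mmat A bas z).
pose kb := 4 * omega ^+ 2 * kappa Q / mu z.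
have kb_le : kappa (Mmat A bas z) <= kb := kappa_le.
have kb0 : 0 <= kb := le_trans K0 kb_le.
have Mn := normF_Mmat A bas x_le s_le.
set plog := lg n%:R * lg (kappa Q) * lg omega.
have plog0 : 0 <= plog.
  by rewrite mulr_ge0 ?lg_ge0// mulr_ge0 ?lg_ge0.
have c0 : 0 <= lg 400 + 5 :> R by rewrite addr_ge0 ?lg_ge0.
set argl := lg _ in ql.
have argl0 : 0 <= argl.
  by rewrite lg_ge0// -mulrA mulr_ge0// mulr_ge0.
have argd : argl ^+ d <= ((lg 400 + 5) * plog) ^+ d.
  by apply: lerXn2r => //; [rewrite nnegrE mulr_ge0 | exact: lg_condition_le].
have ql' : qlsa r k (Mmat A bas z) (sigma z) (mu z) <=
    a * (kb * (2 * omega * opnorm Q) * ((lg 400 + 5) * plog) ^+ d).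
  apply: le_trans ql _; rewrite ler_wpM2l ?(ltW a_gt0)//.
  by apply: ler_pM => //; [exact: mulr_ge0 | exact: exprn_ge0 | exact: ler_pM].
have qt' : qta r k (Mmat A bas z) (sigma z) (mu z) <= a * (n%:R * kb).
  apply: le_trans qt _; rewrite ler_wpM2l ?(ltW a_gt0)//.
  rewrite -[leRHS]mulr1; apply: ler_pM => //; first exact: mulr_ge0.
  exact: ler_wpM2l.
apply: le_trans (ler_pM ql0 qt0 ql' qt') _.
rewrite exprMn /kb.
set c := (lg 400 + 5) ^+ d; set pd := plog ^+ d.
have -> : a * (4 * omega ^+ 2 * kappa Q / mu z * (2 * omega * opnorm Q) * (c * pd)) *
    (a * (n%:R * (4 * omega ^+ 2 * kappa Q / mu z))) =
  32 * a ^+ 2 * c * n%:R * (kappa Q ^+ 2 * opnorm Q * omega ^+ 5 * pd) / mu z * (mu z)^-1.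
  by ring.
have -> : 3200 * a ^+ 2 * c * n%:R ^+ 2 *
    (kappa Q ^+ 2 * opnorm Q * omega ^+ 5 * pd) / mu z =
  32 * a ^+ 2 * c * n%:R * (kappa Q ^+ 2 * opnorm Q * omega ^+ 5 * pd) / mu z *
    (100 * n%:R) by ring.
apply: ler_wpM2l => //.
have i0 : 0 <= (mu z)^-1 by rewrite invr_ge0 ltW.
have c'0 : 0 <= c by exact: exprn_ge0.
have a20 : 0 <= 32 * a ^+ 2 by rewrite mulr_ge0 ?sqr_ge0.
have pd0 : 0 <= pd by exact: exprn_ge0.
have kQ : 0 <= kappa Q ^+ 2 by exact: sqr_ge0.
have o5 : 0 <= omega ^+ 5 by exact: exprn_ge0.
by do ![exact: opnorm_ge0 | assumption | apply: mulr_ge0].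
Qed.

End IterationCosts.

(** * Total complexity *)

(** Iterations whose cost is [E / mu] are summed geometrically in each round, at
    the price of a factor [n], which is at most the input length [l]. *)
Lemma total_bound (R : realType) (a c0 q n s l Pi lgmu lgl lgq N : R) :
  0 < a -> 0 <= c0 -> 0 <= q -> 1 <= n -> 1 <= s -> n <= l -> 1 <= Pi ->
  1 <= lgmu -> 1 <= lgl -> 1 <= lgq -> 0 <= N -> N <= (lgq + 3) * lgl ->
  N * (a * n ^+ 2 + (c0 * n ^+ 2 * Pi * (10000 * (n * s)) +
     a * n ^+ 2 * (1 + 100 * s * (100 + n + lgmu + 2 * (q * l))))) + a * n ^+ 3
  <= ((lgq + 3) * (a + 10000 * c0 + a * (10201 + 200 * q)) + a) *
     (n ^+ 2 * s * l * Pi * (lgmu * lgl)).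
Proof.
move=> a0 c00 q0 n1 s1 nl Pi1 lm1 ll1 lq1 N0 NN.
have l1 : 1 <= l := le_trans n1 nl.
have n0 : 0 <= n by lra.
set W := n ^+ 2 * s * l * Pi * lgmu.
have n20 : 0 <= n ^+ 2 by exact: sqr_ge0.
have slg : 1 <= s * l * lgmu by rewrite !mulr_ege1.
have T1 : n ^+ 2 <= W.
  have -> : W = n ^+ 2 * (s * l * lgmu * Pi) by rewrite /W; ring.
  by rewrite ler_peMr// mulr_ege1.
have T2 : n ^+ 2 * Pi * (n * s) <= W.
  have -> : n ^+ 2 * Pi * (n * s) = n ^+ 2 * s * Pi * n by ring.
  have -> : W = n ^+ 2 * s * Pi * (l * lgmu) by rewrite /W; ring.
  rewrite ler_wpM2l//; first by rewrite !mulr_ge0//; lra.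
  by apply: le_trans nl _; rewrite ler_peMr//; lra.
have T3 : n ^+ 2 * (1 + 100 * s * (100 + n + lgmu + 2 * (q * l))) <= (10201 + 200 * q) * W.
  have slm0 : 0 <= s by lra.
  have -> : (10201 + 200 * q) * W = n ^+ 2 * ((10201 + 200 * q) * (s * l * lgmu) * Pi).
    by rewrite /W; ring.
  rewrite ler_wpM2l//.
  apply: le_trans (_ : (10201 + 200 * q) * (s * l * lgmu) <= _); last first.
    by rewrite ler_peMr// mulr_ge0 ?(le_trans ler01)//; lra.
  have h1 : 100 + n + lgmu + 2 * (q * l) <= (102 + 2 * q) * (l * lgmu).
    have : 1 <= l * lgmu by rewrite mulr_ege1.
    have : n <= l * lgmu by apply: le_trans nl _; rewrite ler_peMr//; lra.
    have : lgmu <= l * lgmu by rewrite ler_peMl//; lra.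
    have : q * l <= q * (l * lgmu) by rewrite ler_wpM2l// ler_peMr//; lra.
    have -> : (102 + 2 * q) * (l * lgmu) = 102 * (l * lgmu) + 2 * (q * (l * lgmu)) by ring.
    by move: (q * (l * lgmu)) (l * lgmu) (q * l) => *; lra.
  have h2 := ler_wpM2l slm0 h1.
  have -> : 100 * s * (100 + n + lgmu + 2 * (q * l)) =
      100 * (s * (100 + n + lgmu + 2 * (q * l))) by ring.
  have e : (10201 + 200 * q) * (s * l * lgmu) =
      s * l * lgmu + 100 * (s * ((102 + 2 * q) * (l * lgmu))) by ring.
  by rewrite e lerD// ler_wpM2l.
have T4 : n ^+ 3 <= W * lgl.
  have -> : W * lgl = n ^+ 2 * (l * (s * Pi * lgmu * lgl)) by rewrite /W; ring.
  by rewrite exprSr ler_wpM2l// (le_trans nl)// ler_peMr ?mulr_ege1// (le_trans n0).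
have W0 : 0 <= W by exact: le_trans T1.
set S := _ + (_ + _).
have SW : S <= (a + 10000 * c0 + a * (10201 + 200 * q)) * W.
  have t1 := ler_wpM2l (ltW a0) T1; have t2 := ler_wpM2l c00 T2.
  have t3 := ler_wpM2l (ltW a0) T3.
  have -> : S = a * n ^+ 2 + (10000 * (c0 * (n ^+ 2 * Pi * (n * s))) +
     a * (n ^+ 2 * (1 + 100 * s * (100 + n + lgmu + 2 * (q * l))))).
    by rewrite /S; ring.
  have -> : (a + 10000 * c0 + a * (10201 + 200 * q)) * W =
    a * W + (10000 * (c0 * W) + a * ((10201 + 200 * q) * W)) by ring.
  by rewrite lerD// lerD// ler_wpM2l.
have S0 : 0 <= S.
  have s0 := le_trans ler01 s1; have l0 := le_trans ler01 l1.
  have lm0 := le_trans ler01 lm1; have Pi0 := le_trans ler01 Pi1.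
  have a0' := ltW a0; rewrite /S.
  by do ![assumption | exact: ler0n | apply: addr_ge0 | apply: mulr_ge0].
have -> : n ^+ 2 * s * l * Pi * (lgmu * lgl) = W * lgl by rewrite /W; ring.
rewrite mulrDl lerD//; last by rewrite ler_wpM2l// ltW.
apply: le_trans (ler_pM N0 S0 NN SW) _.
by rewrite le_eqVlt; apply/orP; left; apply/eqP; ring.
Qed.
Section Assembly.
Variable R : realType.

Lemma powR_five_halves (x : R) : 0 < x -> x `^ (5 / 2) = x ^+ 2 * Num.sqrt x.
Proof.
move=> x0; have -> : 5 / 2 = 2 + 2^-1 :> R by lra.
rewrite powRD; last by rewrite (gt_eqF x0) implybT.
by rewrite powR12_sqrt ?ltW// -(powR_mulrn 2) ?ltW.
Qed.

Lemma dim_le_input_length m n (A : 'M[int]_(m, n)) b c : (n <= input_length A b c)%N.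
Proof.
rewrite /input_length; apply: leq_trans (leq_addl (m * n + m)%N n) _.
by rewrite -!addnA !leq_add2l leq_addr.
Qed.

(** Logarithms in base 2 of the instance [r = N - 1] bound [N - 1] by the sum
    of [lg q] and [lg l]; as both are at least 1, a product bounds the sum. *)
Lemma rounds_lg (q l N : nat) : (0 < l)%N ->
  (forall r, (r < N)%N -> (2 ^ r < q * l)%N) ->
  N.+1%:R <= (lg (q%:R) + 3) * lg (l%:R) :> R.
Proof.
move=> l0 h; have q0 : 0 <= q%:R :> R by []. have lR : 0 <= l%:R :> R by [].
have q1 := lg_ge1 q0; have l1 := lg_ge1 lR.
suff : N%:R <= lg q%:R + lg l%:R + 1 :> R.
  have : lg q%:R <= lg q%:R * lg l%:R :> R by rewrite ler_peMr//; lra.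
  by rewrite -natr1; lra.
case: N h => [_|N /(_ N (ltnSn _)) hN]; first by lra.
rewrite -natr1 lerD2r; apply: le_trans (lgM q0 lR).
have ln2 : 0 < ln 2 :> R by rewrite ln_gt0// ltr1n.
rewrite /lg ler_pdivlMr// (mulr_natl (ln 2)) -lnXn// ler_ln ?posrE ?exprn_gt0//; last first.
  by rewrite ltr_wpDr// mulr_ge0.
rewrite -natrX -natrM; apply: le_trans (_ : (q * l)%:R <= _); last by rewrite lerDr.
by rewrite ler_nat ltnW.
Qed.

(** The constant of both complexity bounds, for a cost of
    [c0 n^2 Pi / mu + a n^2] per iteration. *)
Definition refinement_const (a c0 : R) (q : nat) : R :=
  (lg (q%:R) + 3) * (a + 10000 * c0 + a * (10201 + 200 * q%:R)) + a.

Lemma refinement_const_gt0 a c0 q : 0 < a -> 0 <= c0 -> 0 < refinement_const a c0 q.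
Proof.
move=> a0 c00; rewrite /refinement_const ltr_wpDl//.
have lq : 0 <= lg q%:R :> R by exact: lg_ge0.
have a0' := ltW a0.
by do ![assumption | exact: ler0n | apply: addr_ge0 | apply: mulr_ge0].
Qed.

Lemma refinement_complexity (q : nat) (a c0 theta : R) m p
    (A : 'M[int]_(m, m + p)) b c (bas : 'S_(m + p)) z0 zeta sol ref_cost rnd
    rnd_cost (it_cost : nat -> nat -> triple R m (m + p) -> R) :
  0 < a -> 0 <= c0 -> 2 / 10 <= theta <= 3 / 10 ->
  ir_setting theta q A b c bas z0 zeta ->
  accurate (m := m) (p := p) sol ->
  refinement_spec m p a ref_cost ->
  rounding_spec a (lo_of_int R A b c) zeta rnd rnd_cost ->
  let P := lo_of_int R A b c in
  let n := (m + p)%:R : R in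
  let L := (input_length A b c)%:R : R in
  (exists tr, ir_run bas sol P z0 zeta tr) /\
  forall tr, ir_run bas sol P z0 zeta tr ->
    optimal P (rnd (ir_result tr)) /\
    forall omega Pi : R, 1 <= Pi -> bounds_iterates omega tr ->
    (forall r k z P', lo_A P' = lo_A P -> nbhd theta P' z -> 1 / 100 < gap z ->
       normF (px z) <= omega -> normF (ps z) <= omega ->
       it_cost r k z <= c0 * n ^+ 2 * Pi / mu z + a * n ^+ 2) ->
    total_cost it_cost ref_cost rnd_cost tr
      <= refinement_const a c0 q *
           (n `^ (5 / 2) * L * Pi * (lg (mu z0) * lg L)).
Proof.
move=> a0 c00 th [n_gt0 Af0 ABu0 z0N zge] acc refs rnds P n L.
have Af : row_free (lo_A P) := Af0; have ABu : A_B (lo_A P) bas \in unitmx := ABu0.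
split.
  exact: (ir_run_exists n_gt0 Af ABu th acc z0N zge).
move=> tr run; have [resF resmu] := result_feasible n_gt0 Af ABu th acc z0N run.
have [opt /andP[_ rndc]] := rnds _ resF resmu.
split=> // omega Pi Pi1 bnd itc.
have n1 : 1 <= n by rewrite ler1n.
have n2 : 0 <= n ^+ 2 by exact: sqr_ge0.
have E0 : 0 <= c0 * n ^+ 2 * Pi.
  by rewrite mulr_ge0 ?(le_trans ler01 Pi1)// mulr_ge0.
have F0 : 0 <= a * n ^+ 2 by rewrite mulr_ge0// ltW.
apply: le_trans (total_cost_le n_gt0 Af ABu th acc z0N zge E0 F0 run bnd itc _ rndc) _.
  by move=> r; have /andP[] := refs r.
have l_gt0 : (0 < input_length A b c)%N := leq_trans n_gt0 (dim_le_input_length A b c).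
rewrite powR_five_halves ?ltr0n// natrM.
apply: total_bound => //.
- exact: sqrt_nat_ge1.
- by rewrite ler_nat dim_le_input_length.
- by rewrite lg_ge1// ltW// (nbhd_mu_gt0 n_gt0 z0N).
- exact: lg_ge1.
- exact: lg_ge1.
- exact: rounds_lg (rounds_le n_gt0 Af ABu th acc z0N zge run).
Qed.

End Assembly.

Theorem corollary6p3 (R : realType) (q d : nat) (a : R) (a_gt0 : 0 < a) :
  (* IR-IF-QIPM *)
  (exists (C : R) (D : nat), 0 < C /\
    forall (m p : nat) (A : 'M[int]_(m, m + p)) (b : 'cV[int]_m)
      (c : 'cV[int]_(m + p)) (bas : 'S_(m + p)) (z0 : triple R m (m + p))
      (zeta : R) (sol : solver R (m + p)) (qlsa qta : solver_cost R (m + p))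
      (cls : nat -> nat -> R) (ref_cost : nat -> R)
      (rnd : triple R m (m + p) -> triple R m (m + p))
      (rnd_cost : triple R m (m + p) -> R),
    ir_setting (3 / 10) q A b c bas z0 zeta ->
    quantum_spec a d sol qlsa qta ->
    classical_spec (m + p) a cls ->
    refinement_spec m p a ref_cost ->
    rounding_spec a (lo_of_int R A b c) zeta rnd rnd_cost ->
    let P := lo_of_int R A b c in
    let n := (m + p)%:R : R in
    let L := (input_length A b c)%:R : R in
    let Q := Qmat (lo_A P) bas in
    (exists tr, ir_run bas sol P z0 zeta tr) /\
    forall tr, ir_run bas sol P z0 zeta tr ->
      optimal P (rnd (ir_result tr)) /\
      forall omega : R, 1 <= omega -> bounds_iterates omega tr ->
      total_cost (quantum_it_cost (lo_A P) bas qlsa qta cls) ref_cost rnd_cost tr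
        <= C * (n `^ (5 / 2) * L * kappa Q ^+ 2 * opnorm Q * omega ^+ 5)
             * (lg n * lg (kappa Q) * lg omega * lg (mu z0) * lg L) ^+ D)
  /\
  (* IR-IF-IPM with the conjugate gradient method *)
  (exists (C : R) (D : nat), 0 < C /\
    forall (m p : nat) (A : 'M[int]_(m, m + p)) (b : 'cV[int]_m)
      (c : 'cV[int]_(m + p)) (bas : 'S_(m + p)) (z0 : triple R m (m + p))
      (zeta : R) (sol : solver R (m + p)) (cgm : solver_cost R (m + p))
      (cls : nat -> nat -> R) (ref_cost : nat -> R)
      (rnd : triple R m (m + p) -> triple R m (m + p))
      (rnd_cost : triple R m (m + p) -> R),
    ir_setting (2 / 10) q A b c bas z0 zeta ->
    cgm_spec a sol cgm ->
    classical_spec (m + p) a cls ->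
    refinement_spec m p a ref_cost ->
    rounding_spec a (lo_of_int R A b c) zeta rnd rnd_cost ->
    let P := lo_of_int R A b c in
    let n := (m + p)%:R : R in
    let L := (input_length A b c)%:R : R in
    let Q := Qmat (lo_A P) bas in
    (exists tr, ir_run bas sol P z0 zeta tr) /\
    forall tr, ir_run bas sol P z0 zeta tr ->
      optimal P (rnd (ir_result tr)) /\
      forall omega : R, 1 <= omega -> bounds_iterates omega tr ->
      total_cost (cgm_it_cost (lo_A P) bas cgm cls) ref_cost rnd_cost tr
        <= C * (n `^ (5 / 2) * L * kappa Q * omega ^+ 2)
             * (lg (mu z0) * lg L) ^+ D).
Proof.
have c10 : 0 <= 3200 * a ^+ 2 * (lg 400 + 5) ^+ d :> R.
  apply: mulr_ge0; first by rewrite mulr_ge0 ?sqr_ge0.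
  by apply: exprn_ge0; rewrite addr_ge0 ?lg_ge0.
have c20 : 0 <= 4 * a * lg 1 :> R by rewrite mulr_ge0 ?lg_ge0// mulr_ge0// ltW.
split.
  exists (refinement_const a (3200 * a ^+ 2 * (lg 400 + 5) ^+ d) q), d.+1.
  split; first exact: refinement_const_gt0.
  move=> m p A b c bas z0 zeta sol qlsa qta cls ref_cost rnd rnd_cost sett qspec
    cspec refs rnds P n L Q.
  have [n_gt0 Af0 ABu0 z0N _] := sett.
  have Af : row_free (lo_A P) := Af0.
  have ABu : A_B (lo_A P) bas \in unitmx := ABu0.
  have th : (2 / 10 <= 3 / 10 :> R) && (3 / 10 <= 3 / 10 :> R) by rewrite lexx andbT; lra.
  have acc : accurate (m := m) (p := p) sol.
    by move=> r k M sig nu Mu nu0; have [] := qspec r k M sig nu Mu nu0.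
  have [ex all_runs] := refinement_complexity
    (quantum_it_cost (lo_A P) bas qlsa qta cls) a_gt0 c10 th sett acc refs rnds.
  split=> // tr run; have [opt cost] := all_runs tr run; split=> // omega om1 bnd.
  have kQ1 : 1 <= kappa Q by apply: kappa_ge1 n_gt0; exact: Qmat_free.
  have oQ1 : 1 <= opnorm Q by apply: opnorm_Qmat_ge1.
  have n1 : 1 <= n by rewrite ler1n.
  set plog := lg n * lg (kappa Q) * lg omega.
  have plog1 : 1 <= plog.
    by do ![exact: lg_ge1 | apply: lg_ge1; exact: (le_trans ler01) |
            apply: mulr_ege1].
  have Pi1 : 1 <= kappa Q ^+ 2 * opnorm Q * omega ^+ 5 * plog ^+ d.
    by do ![assumption | apply: exprn_ege1 | apply: mulr_ege1].
  apply: le_trans (cost omega _ Pi1 bnd _) _.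
    move=> r k z P' PA zN gz xo so.
    exact: (quantum_it_cost_le n_gt0 Af ABu th a_gt0 om1 PA zN xo so gz r k qspec cspec).
  have lm1 : 1 <= lg (mu z0) by rewrite lg_ge1// ltW// (nbhd_mu_gt0 n_gt0 z0N).
  have lL1 : 1 <= lg L by rewrite lg_ge1.
  set C := refinement_const _ _ _; have C0 : 0 < C by exact: refinement_const_gt0.
  rewrite -[leRHS]mulrA ler_pM2l//.
  have -> : n `^ (5 / 2) * L * (kappa Q ^+ 2 * opnorm Q * omega ^+ 5 * plog ^+ d) *
      (lg (mu z0) * lg L) = n `^ (5 / 2) * L * kappa Q ^+ 2 * opnorm Q * omega ^+ 5 *
      (plog ^+ d * (lg (mu z0) * lg L)) by ring.
  rewrite ler_wpM2l//.
    have kQ0 := le_trans ler01 kQ1; have oQ0 := le_trans ler01 oQ1.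
    have om0 := le_trans ler01 om1.
    by do ![assumption | exact: ler0n | exact: powR_ge0 | apply: exprn_ge0 | apply: mulr_ge0].
  have [plog0 lm0 lL0] : [/\ 0 <= plog, 0 <= lg (mu z0) & 0 <= lg L].
    by split; apply: le_trans ler01 _.
  have le_pow (x : R) k : 1 <= x -> x <= x ^+ k.+1.
    by move=> x1; rewrite exprS ler_peMr ?exprn_ege1// (le_trans ler01).
  have -> : (lg n * lg (kappa Q) * lg omega * lg (mu z0) * lg L) ^+ d.+1 =
      plog ^+ d.+1 * (lg (mu z0) * lg L) ^+ d.+1.
    by rewrite -exprMn; congr (_ ^+ _); exact: (esym (mulrA plog _ _)).
  apply: ler_pM.
  - exact: exprn_ge0.
  - exact: mulr_ge0.
  - by rewrite exprS ler_peMl// exprn_ge0.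
  - by apply: le_pow; exact: mulr_ege1.
exists (refinement_const a (4 * a * lg 1) q), 1%N.
split; first exact: refinement_const_gt0.
move=> m p A b c bas z0 zeta sol cgm cls ref_cost rnd rnd_cost sett gspec
  cspec refs rnds P n L Q.
have [n_gt0 Af0 ABu0 z0N _] := sett.
have Af : row_free (lo_A P) := Af0.
have ABu : A_B (lo_A P) bas \in unitmx := ABu0.
have th : (2 / 10 <= 2 / 10 :> R) && (2 / 10 <= 3 / 10 :> R) by rewrite lexx /=; lra.
have acc : accurate (m := m) (p := p) sol.
  by move=> r k M sig nu Mu nu0; have [[j []]] := gspec r k M sig nu Mu nu0.
have [ex all_runs] := refinement_complexity
  (cgm_it_cost (lo_A P) bas cgm cls) a_gt0 c20 th sett acc refs rnds.
split=> // tr run; have [opt cost] := all_runs tr run; split=> // omega om1 bnd.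
have kQ1 : 1 <= kappa Q by apply: kappa_ge1 n_gt0; exact: Qmat_free.
have Pi1 : 1 <= kappa Q * omega ^+ 2 by rewrite mulr_ege1 ?exprn_ege1.
apply: le_trans (cost omega _ Pi1 bnd _) _.
  move=> r k z P' PA zN gz xo so.
  exact: (cgm_it_cost_le n_gt0 Af ABu th a_gt0 PA zN xo so r k gspec cspec).
by rewrite expr1 le_eqVlt; apply/orP; left; apply/eqP; ring.
Qed.
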